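(* Assume that for every $x^*\in E^*$ the weak limit $Q_\infty x^*=\text{weak-}\lim_{t\to\infty}Q_tx^*$ exists in $E$. If $S$ restricts to a $C_0$-semigroup $S_H$ on $H$, the following assertions are equivalent: (1) $S_H$ is uniformly exponentially stable; (2) $S_\infty$ is uniformly exponentially stable; (3) for some $t>0$ we have $H_t=H_\infty$ with equivalent norms; (4) for all $t>0$ we have $H_t=H_\infty$ with equivalent norms; (5) $H_\infty\subseteq H$. In this situation, the inclusion $H_\infty\subseteq H$ is dense.
   Context: $E$ is a real Banach space with dual $E^*$; $S=\{S(t)\}_{t\ge0}$ is a $C_0$-semigroup of bounded linear operators on $E$ with adjoint operators $S^*(t)$ on $E^*$. $H$ is a real Hilbert space with a continuous injective linear map $i:H\to E$; $H$ is identified with its image in $E$, and $Q:=i\circ i^*\in\mathcal L(E^*,E)$ ($H$ being identified with its dual). For $t>0$, $Q_t x^*:=\int_0^t S(s)QS^*(s)x^*\,ds$ for $x^*\in E^*$. ''$S$ restricts to a $C_0$-semigroup $S_H$ on $H$'' means that $S(t)H\subseteq H$ for all $t\ge0$ and the restrictions $S_H(t)=S(t)|_H$ form a $C_0$-semigroup on $H$. An operator $R\in\mathcal L(E^*,E)$ is positive if $\langle Rx^*,x^*\rangle\ge0$ and symmetric if $\langle Rx^*,y^*\rangle=\langle Ry^*,x^*\rangle$ for all $x^*,y^*\in E^*$. For such $R$, its reproducing kernel Hilbert space (RKHS) is the completion $H_R$ of the range of $R$ for the inner product $(Rx^*,Ry^* )\mapsto\langle Rx^*,y^*\rangle$; the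 inclusion of the range of $R$ in $E$ extends to a continuous injection $i_R:H_R\to E$ with $R=i_R\circ i_R^*$, and $H_R$ is identified with its image in $E$. $H_t$ and $H_\infty$ are the RKHS's of $Q_t$ and $Q_\infty$. The space $H_\infty$ is invariant under $S$, and the restriction $S_\infty$ of $S$ to $H_\infty$ is a $C_0$-semigroup of contractions on $H_\infty$. A semigroup $T$ is uniformly exponentially stable if there are $M\ge0$ and $\omega>0$ with $\|T(t)\|\le Me^{-\omega t}$ for all $t\ge0$. *)

(* Defs.v *)
From HB Require Import structures.
From mathcomp Require Import all_boot all_order all_algebra.
From mathcomp Require Import all_classical all_reals all_analysis.

Set Implicit Arguments.
Unset Strict Implicit.
Unset Printing Implicit Defensive.

Import Order.TTheory GRing.Theory Num.Theory.
Import numFieldNormedType.Exports.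
Local Open Scope classical_set_scope.
Local Open Scope ring_scope.

(* Elements of the dual are plain functions E -> R; operators defined on the
   dual are total functions on E -> R whose values outside [dual E] are never
   used. *)
Definition dual (R : realType) (E : normedModType R) : set (E -> R) :=
  [set f : E -> R | scalar f /\ continuous f].

Definition weak_cvg (R : realType) (E : normedModType R) (T : Type)
    (f : T -> E) (F : set_system T) (x : E) : Prop :=
  forall y, dual y -> y (f t) @[t --> F] --> y x.

Definition C0_semigroup (R : realType) (V : normedModType R)
    (T : R -> {linear V -> V}) : Prop :=
  [/\ forall t, 0 <= t -> continuous (T t),
      forall x, T 0 x = x,
      forall s t, 0 <= s -> 0 <= t -> forall x, T (s + t) x = T s (T t x)
    & forall x, T t x @[t --> 0^'+] --> x].

(* Uniform exponential stability of the part of T in a T-invariant subspace D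
   normed by N; the bound for all x in D says that the operator norm of T(t)
   on (D, N) is at most M e^{- w t}. *)
Definition unif_exp_stable (R : realType) (V : Type) (D : set V) (N : V -> R)
    (T : R -> V -> V) : Prop :=
  exists M w : R, [/\ 0 <= M, 0 < w &
    forall t, 0 <= t -> forall x, D x ->
      D (T t x) /\ N (T t x) <= M * expR (- (w * t)) * N x].

(* Real Hilbert space: a complete normed space H together with an inner
   product inducing its norm. *)
Definition induces_norm (R : realType) (H : normedModType R)
    (ip : {dot H for (idfun : R -> R)}) : Prop :=
  forall h, `|h| ^+ 2 = ip h h.

(* The vector representing a continuous linear functional on H (Riesz). *)
Definition riesz (R : realType) (H : completeNormedModType R)
    (ip : {dot H for (idfun : R -> R)}) (phi : H -> R) : H :=
  get [set h | forall k, phi k = ip k h].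

(* Q = i o i^*, with H identified with its dual; i^* x = x o i. *)
Definition covQ (R : realType) (E H : completeNormedModType R)
    (ip : {dot H for (idfun : R -> R)}) (i : H -> E) (x : E -> R) : E :=
  i (riesz ip (x \o i)).

(* Bochner integral for Lebesgue measure on D: f is the a.e. limit in D of simple
   functions s_n with int_D |f - s_n| -> 0, and v = lim int_D s_n. *)
Definition bochner_simple (R : realType) (V : normedModType R) (D : set R)
    (s : R -> V) : Prop :=
  [/\ finite_set (s @` D),
      forall v, measurable (D `&` s @^-1` [set v])
    & forall v, v != 0 ->
        (lebesgue_measure (D `&` s @^-1` [set v]) < +oo)%E].

Definition simple_integral (R : realType) (V : normedModType R) (D : set R)
    (s : R -> V) : V :=
  \sum_(v \in s @` D) fine (lebesgue_measure (D `&` s @^-1` [set v])) *: v.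

Definition is_bochner_integral (R : realType) (V : normedModType R)
    (D : set R) (f : R -> V) (v : V) : Prop :=
  exists s : nat -> R -> V,
    [/\ forall n, bochner_simple D (s n),
        {ae @lebesgue_measure R,
          forall r, D r -> s n r @[n --> \oo] --> f r},
        (\int[lebesgue_measure]_(r in D) (`|f r - s n r|)%:E)%E
          @[n --> \oo] --> 0%E
      & simple_integral D (s n) @[n --> \oo] --> v].

Definition bochner_integral (R : realType) (V : completeNormedModType R)
    (D : set R) (f : R -> V) : V :=
  get (is_bochner_integral D f).

(* Q_t x = int_0^t S(s) Q S^*(s) x ds, where S^*(s) x = x o S(s) *)
Definition covQt (R : realType) (E H : completeNormedModType R)
    (ip : {dot H for (idfun : R -> R)}) (i : H -> E)
    (S : R -> E -> E) (t : R) (x : E -> R) : E :=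
  bochner_integral `[0, t] (fun s => S s (covQ ip i (x \o S s))).

(* The reproducing kernel Hilbert space H_A of a positive symmetric operator
   A : E^* -> E, as a subset of E carrying its own norm.  The norm of A x is
   <A x, x>^(1/2); an element of the completion is represented by a sequence u
   in E^* such that (A (u n)) is Cauchy for this norm, and the continuous
   injection i_A sends it to the limit in E of A (u n). *)
Section rkhs.
Context (R : realType) (E : completeNormedModType R) (A : (E -> R) -> E).

Definition range_norm (x : E -> R) : R := Num.sqrt (x (A x)).

Definition rkhs_repr (h : E) (u : nat -> E -> R) : Prop :=
  [/\ forall n, dual (u n),
      forall e : R, 0 < e -> exists N : nat, forall m n : nat,
        (N <= m)%N -> (N <= n)%N -> range_norm (u m \- u n) < e
    & A (u n) @[n --> \oo] --> h].

Definition rkhs : set E := [set h | exists u, rkhs_repr h u].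

Definition rkhs_norm (h : E) : R :=
  lim (range_norm (get (rkhs_repr h) n) @[n --> \oo]).

End rkhs.

Definition eq_equiv_norms (R : realType) (V : Type) (D1 : set V) (N1 : V -> R)
    (D2 : set V) (N2 : V -> R) : Prop :=
  D1 = D2 /\
  exists c C : R, [/\ 0 < c, 0 < C &
    forall x, D1 x -> c * N1 x <= N2 x <= C * N1 x].

(* Main.v *)
Require Import Defs.
From HB Require Import structures.
From mathcomp Require Import all_boot all_order all_algebra.
From mathcomp Require Import all_classical all_reals all_analysis.
From mathcomp Require Import measurable_realfun ring lra.

Set Implicit Arguments.
Unset Strict Implicit.
Unset Printing Implicit Defensive.

Import Order.TTheory GRing.Theory Num.Theory.
Import numFieldNormedType.Exports.
Local Open Scope classical_set_scope.
Local Open Scope ring_scope.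

(** Let [a] be the adjoint of [S_H], and call energy of [h] up to time [t] the
    integral of [|a_s h|^2] from [0] to [t]. As [S(s) i = i S_H(s)], the integrand
    of [Q_t x] is [i S_H(s) a_s i^* x], so that [<Q_t x, x>] is the energy of
    [i^* x] up to time [t], and [<Q_inf x, x>] its energy over the half-line.

    An element [h] belongs to the reproducing kernel Hilbert space of [A] with
    norm at most [C] exactly when [|y h| <= C <A y, y>^(1/2)] for all functionals
    [y] ([rkhs_normP], [rkhs_bounded]). The space [H] itself is that of
    [i \o i^*] ([range_bounded]). So the theorem is about three seminorms on the
    dual: [pt t x = <Q_t x, x>^(1/2)], its supremum [pinf x] over [t], and
    [|i^* x|].

    (1) implies (2): [pinf (x \o S t)] measures the energy of [i^* x] left after
    time [t], and is at most the norm of [a_t] times [pinf x] ([pinf_orbit]).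

    (2) implies (3): decay of [S] on [H_inf] is by duality decay of
    [pinf (x \o S t)] ([pinf_orbit_of_Hinf_stable]). At some time at most half of
    [pinf] is left, and then [pinf <= C * pt t].

    (3) implies (4): as [pt t] is dominated by [|i^* x|], so is [pinf]. The range
    of [i^*] is dense, hence all orbits of [a] are square integrable, and Datko's
    theorem makes [a] and [S_H] exponentially stable ([datko],
    [stable_of_bound]). Then [pinf] is dominated by each [pt t]
    ([equiv_norms_of_stable]).

    (4) implies (5): [pinf] is dominated by [|i^* x|], which means that [H_inf] is
    contained in [H].

    (5) implies (1): by a closed graph argument the inclusion is bounded, so that
    [pinf] is dominated by [|i^* x|] ([bound_of_subset]), and Datko's theorem
    applies again.

    Density: a vector [g] orthogonal to [H_inf] is orthogonal to all [Q_inf y];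
    letting [i^* y] tend to [g] shows that [g] has no energy, so [g = 0]
    ([Hinf_dense]).

    The preliminaries are the Hahn-Banach theorem, the Riesz representation by
    Cauchy minimising sequences, a gliding hump argument for such sequences (it
    bounds symmetric operators on the dual and proves the closed graph step), the
    weak description of the Bochner integral of a continuous function, and the
    strong continuity of the adjoint semigroup. *)

(** * The Hahn-Banach theorem *)

Section HahnBanach.
Context (R : realType).

Definition sublinear (V : lmodType R) (q : V -> R) : Prop :=
  (forall x y, q (x + y) <= q x + q y) /\
  (forall c x, 0 < c -> q (c *: x) <= c * q x).

Lemma sublinear0 (V : lmodType R) (q : V -> R) : sublinear q -> q 0 = 0.
Proof.
move=> [qD qZ]; have := qD 0 0; have := qZ 2^-1 0 (_ : 0 < 2^-1).
by rewrite addr0 scaler0 invr_gt0 ltr0n => /(_ isT); lra.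
Qed.

Lemma sublinear_oppr_ge (V : lmodType R) (q : V -> R) x :
  sublinear q -> - q (- x) <= q x.
Proof.
move=> sq; have := sq.1 x (- x); rewrite subrr (sublinear0 sq); lra.
Qed.

Definition pointwise_inf (V : Type) (A : set (V -> R)) (x : V) : R :=
  inf [set q x | q in A].

Lemma sublinear_inf (V : lmodType R) (p : V -> R) (A : set (V -> R)) :
  A !=set0 ->
  (forall q, A q -> sublinear q /\ forall x, q x <= p x) ->
  (forall q1 q2, A q1 -> A q2 ->
     (forall x, q1 x <= q2 x) \/ (forall x, q2 x <= q1 x)) ->
  sublinear (pointwise_inf A) /\
  forall q, A q -> forall x, pointwise_inf A x <= q x.
Proof.
move=> [a0 Aa0] Asub Atot; set q := pointwise_inf A.
have qle q' : A q' -> forall x, q x <= q' x.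
  move=> Aq' x; apply: ge_inf; last by exists q'.
  exists (- p (- x)) => _ [b Ab <-]; have [sb bp] := Asub _ Ab.
  by rewrite (le_trans _ (sublinear_oppr_ge x sb))// lerN2.
have gq c x : (forall q', A q' -> c <= q' x) -> c <= q x.
  by move=> h; apply: lb_le_inf; [exists (a0 x), a0|by move=> _ [b Ab <-]; exact: h].
split; last exact: qle.
split=> [x y|c x c0].
  rewrite -lerBlDr; apply: (gq _ _) => b Ab; rewrite lerBlDr -lerBlDl.
  apply: (gq _ _) => d Ad; rewrite lerBlDl.
  have [bd|db] := Atot _ _ Ab Ad.
    apply: (le_trans (qle _ Ab _)); apply: (le_trans ((Asub _ Ab).1.1 _ _)).
    exact: lerD.
  apply: (le_trans (qle _ Ad _)); apply: (le_trans ((Asub _ Ad).1.1 _ _)).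
  exact: lerD.
rewrite -ler_pdivrMl//; apply: (gq _ _) => b Ab; rewrite ler_pdivrMl//.
by apply: (le_trans (qle _ Ab _)); exact: ((Asub _ Ab).1.2).
Qed.

(** Lowering [q] as far as sublinearity permits so that its value at [- y]
    drops to at most [- q y]: a first step towards an odd, hence linear,
    functional. *)
Definition lower_along (V : lmodType R) (q : V -> R) (y x : V) : R :=
  inf [set q (x + t *: y) - t * q y | t in [set t | 0 <= t]].

Lemma lower_along_le (V : lmodType R) (q : V -> R) (x y : V) t :
  sublinear q -> 0 <= t -> lower_along q y x <= q (x + t *: y) - t * q y.
Proof.
move=> sq t0; apply: ge_inf; last by exists t.
exists (- q (- x)) => _ [s /= s0 <-].
have := sq.1 (x + s *: y) (- x); rewrite addrAC subrr add0r.
have [->|sn0] := eqVneq s 0.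
  by rewrite scale0r addr0 mul0r sublinear0//; lra.
have {}s0 : 0 < s by rewrite lt_def sn0.
have := sq.2 s^-1 (s *: y); rewrite invr_gt0 => /(_ s0).
by rewrite scalerA mulVf ?gt_eqF// scale1r ler_pdivlMl//; lra.
Qed.

Lemma sublinear_lower_along (V : lmodType R) (q : V -> R) (y : V) :
  sublinear q -> sublinear (lower_along q y).
Proof.
move=> sq.
have ge1 c x : (forall t, 0 <= t -> c <= q (x + t *: y) - t * q y) ->
    c <= lower_along q y x.
  move=> h; apply: lb_le_inf; last by move=> _ [t t0 <-]; exact: h.
  by exists (q (x + 0 *: y) - 0 * q y), 0 => /=.
split=> [x1 x2|c x c0].
  rewrite -lerBlDr; apply: (ge1 _ _) => s s0; rewrite lerBlDr -lerBlDl.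
  apply: (ge1 _ _) => t t0; rewrite lerBlDl.
  have := @lower_along_le _ q (x1 + x2) y _ sq (addr_ge0 s0 t0).
  have := sq.1 (x1 + s *: y) (x2 + t *: y).
  by rewrite scalerDl addrACA mulrDl; lra.
rewrite -ler_pdivrMl//; apply: (ge1 _ _) => t t0; rewrite ler_pdivrMl//.
have := @lower_along_le _ q (c *: x) y _ sq (mulr_ge0 (ltW c0) t0).
by have := sq.2 c (x + t *: y) c0; rewrite scalerDr scalerA mulrBr mulrA => h1 h2; lra.
Qed.

Lemma lower_along_le_id (V : lmodType R) (q : V -> R) (x y : V) :
  sublinear q -> lower_along q y x <= q x.
Proof.
move=> sq; have := @lower_along_le _ q x y 0 sq (lexx _).
by rewrite scale0r addr0 mul0r subr0.
Qed.

(** A sublinear functional that is minimal for the pointwise order is linear: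
    it cannot be lowered along any ray, which makes it additive. *)
Lemma minimal_sublinear_scalar (V : lmodType R) (q : V -> R) : sublinear q ->
  (forall q', sublinear q' -> (forall x, q' x <= q x) -> q' = q) -> scalar q.
Proof.
move=> sq qmin.
have qD x y : q (x + y) = q x + q y.
  apply/eqP; rewrite eq_le sq.1/=.
  have := @lower_along_le _ q x y 1 sq ler01.
  rewrite (qmin _ (sublinear_lower_along y sq) (fun x => lower_along_le_id x y sq)).
  by rewrite scale1r mul1r; lra.
have qN x : q (- x) = - q x.
  by have := qD x (- x); rewrite subrr (sublinear0 sq); lra.
have qZ c x : 0 < c -> q (c *: x) = c * q x.
  move=> c0; apply/eqP; rewrite eq_le sq.2//=.
  by have := sq.2 c (- x) c0; rewrite scalerN !qN mulrN lerN2.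
move=> c x y; rewrite qD; congr (_ + _).
have [c0|c0|<-] := ltgtP 0 c; first exact: qZ.
  by rewrite -[c in LHS]opprK scaleNr qN qZ ?oppr_gt0//= mulNr opprK.
by rewrite scale0r (sublinear0 sq) /= mul0r.
Qed.

(** Zorn's lemma applies below [p] because [- p (- x)] is a lower bound at [x]
    of all sublinear functionals in the chain, so that their pointwise infimum
    is finite and again sublinear. *)
Lemma sublinear_minorant (V : lmodType R) (p : V -> R) : sublinear p ->
  exists f : V -> R, scalar f /\ forall x, f x <= p x.
Proof.
move=> sp; pose T := {q : V -> R | sublinear q /\ forall x, q x <= p x}.
pose le (q1 q2 : T) : bool := `[< forall x, sval q2 x <= sval q1 x >].
have [] := @Zorn T le.
- by move=> q; apply/asboolP.
- move=> q1 q2 q3 /asboolP h12 /asboolP h23; apply/asboolP => x.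
  exact: le_trans (h23 x) (h12 x).
- move=> [q1 h1] [q2 h2] /asboolP/= h12 /asboolP/= h21.
  have E : q1 = q2 by apply/funext => x; apply/eqP; rewrite eq_le h12 h21.
  by subst q2; congr (exist _ _ _); exact: Prop_irrelevance.
- move=> A Atot; have [[a0 Aa0]|A0] := pselect (A !=set0); last first.
    by exists (exist _ p (conj sp (fun x => lexx _))) => s As; case: A0; exists s.
  pose A' := [set sval q | q in A].
  have [||| sq qle] := @sublinear_inf V p A'.
  + by exists (sval a0), a0.
  + by move=> _ [[q hq] _ <-].
  + move=> _ _ [q1 A1 <-] [q2 A2 <-].
    by have [/asboolP|/asboolP] := Atot _ _ A1 A2; [right|left].
  have qp x : pointwise_inf A' x <= p x.
    by rewrite (le_trans (qle (sval a0) _ x)) ?(svalP a0).2//; exists a0.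
  exists (exist _ (pointwise_inf A') (conj sq qp)) => s As; apply/asboolP => x /=.
  by apply: qle; exists s.
- move=> [q [sq qp]] qmax; exists q; split=> //.
  apply: minimal_sublinear_scalar => // q' sq' q'q.
  have q'p x : q' x <= p x := le_trans (q'q x) (qp x).
  by have /(_ _)/(congr1 sval) := qmax (exist _ q' (conj sq' q'p)); apply;
    apply/asboolP.
Qed.

Lemma scalar_funB (V : lmodType R) (f : V -> R) : scalar f ->
  forall x y, f (x - y) = f x - f y.
Proof.
move=> lf.
pose g : {scalar V} := HB.pack f (GRing.isLinear.Build _ _ _ _ _ lf).
exact: (linearB g).
Qed.

Lemma scalar_funN (V : lmodType R) (f : V -> R) : scalar f ->
  forall x, f (- x) = - f x.
Proof.
move=> lf.
pose g : {scalar V} := HB.pack f (GRing.isLinear.Build _ _ _ _ _ lf).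
exact: (linearN g).
Qed.

Lemma scalar_fun0 (V : lmodType R) (f : V -> R) : scalar f -> f 0 = 0.
Proof. by move=> lf; rewrite -(subrr 0) (scalar_funB lf) subrr. Qed.

Lemma scalar_funZ (V : lmodType R) (f : V -> R) : scalar f ->
  forall a x, f (a *: x) = a * f x.
Proof. by move=> lf a x; rewrite -[a *: x]addr0 lf scalar_fun0// addr0. Qed.

Lemma scalar_bounded_continuous (E : normedModType R) (f : E -> R) C :
  scalar f -> (forall e, `|f e| <= C * `|e|) -> continuous f.
Proof.
move=> lf fC.
pose g : {linear E -> R^o} := HB.pack f (GRing.isLinear.Build _ _ _ _ _ lf).
apply: (@bounded_linear_continuous _ _ _ g); apply/linear_boundedP.
exists C; split; first exact: num_real.
by move=> r /ltW Cr x; rewrite (le_trans (fC x))// ler_wpM2r.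
Qed.

Lemma dual_bounded (E : normedModType R) (f : E -> R) :
  dual f -> exists2 C, 0 < C & forall e, `|f e| <= C * `|e|.
Proof.
move=> [lf cf].
pose g : {linear E -> R^o} := HB.pack f (GRing.isLinear.Build _ _ _ _ _ lf).
exact: (@linear_lipschitz _ _ _ g cf).
Qed.

(** Any linear minorant of the norm lowered along the ray of [e] will do: it is
    below the norm, and its value at [- e] is at most [- |e|]. *)
Lemma norming_functional (E : normedModType R) (e : E) :
  exists y : E -> R, [/\ dual y, forall x, `|y x| <= `|x| & y e = `|e|].
Proof.
have sn : sublinear (fun x : E => `|x|).
  by split=> [x y|c x c0]; [exact: ler_normD|rewrite normrZ gtr0_norm].
have [f [lf fp]] := sublinear_minorant (sublinear_lower_along e sn).
have fn x : f x <= `|x| := le_trans (fp x) (lower_along_le_id _ _ sn).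
have fb x : `|f x| <= `|x|.
  by rewrite ler_norml fn andbT lerNl -(scalar_funN lf) -(normrN x).
exists f; split=> //.
  by split=> //; apply: (scalar_bounded_continuous (C := 1)) => // x; rewrite mul1r.
apply/eqP; rewrite eq_le fn/=.
have := le_trans (fp (- e)) (@lower_along_le _ _ (- e) e 1 sn ler01).
by rewrite scale1r addNr normr0 mul1r sub0r (scalar_funN lf) lerN2.
Qed.

Lemma dual_separates (E : normedModType R) (e1 e2 : E) :
  (forall y, dual y -> y e1 = y e2) -> e1 = e2.
Proof.
move=> h; have [y [dy _ ye]] := norming_functional (e1 - e2).
apply/eqP; rewrite -subr_eq0 -normr_eq0 -ye.
by rewrite (scalar_funB dy.1) h// subrr.
Qed.

End HahnBanach.

(** * Sequences *)

Section Sequences.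
Context (R : realType).

Lemma cvg_seqP (V : normedModType R) (u : nat -> V) (l : V) :
  u n @[n --> \oo] --> l <->
  forall e : R, 0 < e -> exists N : nat, forall n, (N <= n)%N -> `|u n - l| < e.
Proof.
split=> [/cvgrPdist_lt h e e0|h].
  by have [N _ hN] := h e e0; exists N => n Nn; rewrite distrC; exact: hN.
apply/cvgrPdist_lt => e e0; have [N hN] := h e e0.
by exists N => // n /= Nn; rewrite distrC; exact: hN.
Qed.

Lemma cauchy_seq_cvg (V : completeNormedModType R) (u : nat -> V) :
  (forall e : R, 0 < e -> exists N : nat, forall m n,
     (N <= m)%N -> (N <= n)%N -> `|u m - u n| < e) ->
  exists l : V, u n @[n --> \oo] --> l.
Proof.
move=> h; suff : cvg (u n @[n --> \oo]) by move=> /cvg_ex.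
apply: cauchy_cvg; apply: cauchy_exP => e e0; have [N hN] := h e e0.
by exists (u N), N => // n /= Nn; rewrite -ball_normE; apply: hN.
Qed.

Lemma cvg_seq_le (u : nat -> R) (l c : R) (N : nat) :
  u n @[n --> \oo] --> l -> (forall n, (N <= n)%N -> u n <= c) -> l <= c.
Proof.
move=> ul h; apply/ler_addgt0Pr => e e0; have [M hM] := (cvg_seqP _ _).1 ul e e0.
have := hM _ (leq_maxr N M); have := h _ (leq_maxl N M).
by rewrite ltr_norml => h1 /andP[h2 _]; lra.
Qed.

End Sequences.

(** * Positive forms and the Riesz representation *)

Section PositiveForms.
Context (R : realType) (V : lmodType R).

Definition linear_subspace (D : set V) : Prop :=
  D 0 /\ forall a x y, D x -> D y -> D (a *: x + y).

Definition positive_form (D : set V) (B : V -> V -> R) : Prop :=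
  [/\ forall a x y z, D x -> D y -> D z -> B (a *: x + y) z = a * B x z + B y z,
      forall x y, D x -> D y -> B x y = B y x
    & forall x, D x -> 0 <= B x x].

Definition form_norm (B : V -> V -> R) (x : V) : R := Num.sqrt (B x x).

Context (D : set V) (B : V -> V -> R).
Hypotheses (sD : linear_subspace D) (pB : positive_form D B).

Local Notation nm := (form_norm B).

Lemma subspaceB x y : D x -> D y -> D (x - y).
Proof. by move=> Dx Dy; rewrite addrC -scaleN1r; apply: sD.2. Qed.

Lemma subspaceZ a x : D x -> D (a *: x).
Proof. by move=> Dx; rewrite -[_ *: _]addr0; apply: sD.2 => //; exact: sD.1. Qed.

Lemma form_quad a x y : D x -> D y ->
  B (a *: x + y) (a *: x + y) = a ^+ 2 * B x x + 2 * a * B x y + B y y.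
Proof.
have [Bl Bs Bp] := pB; move=> Dx Dy; have Dxy : D (a *: x + y) by apply: sD.2.
rewrite Bl// (Bs x)// (Bs y _ Dy Dxy) !Bl//.
by rewrite (Bs y x)//; ring.
Qed.

Lemma form_normK x : D x -> nm x ^+ 2 = B x x.
Proof. by have [_ _ Bp] := pB; move=> Dx; rewrite sqr_sqrtr// Bp. Qed.

Lemma form_norm_ge0 x : 0 <= nm x.
Proof. exact: sqrtr_ge0. Qed.

Lemma form_cauchy_schwarz x y : D x -> D y -> `|B x y| <= nm x * nm y.
Proof.
move=> Dx Dy; have [Bl Bs Bp] := pB.
rewrite -(ler_pXn2r (n := 2))// ?nnegrE ?mulr_ge0 ?form_norm_ge0//.
rewrite exprMn !form_normK// real_normK ?num_real//.
have q a := Bp _ (sD.2 a x y Dx Dy).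
have [x0|x0] := eqVneq (B x x) 0; last first.
  have x1 : 0 < B x x by rewrite lt_def x0 Bp.
  have := q (- B x y / B x x); rewrite form_quad//.
  have -> : (- B x y / B x x) ^+ 2 * B x x + 2 * (- B x y / B x x) * B x y + B y y
    = B y y - B x y ^+ 2 / B x x by field.
  by rewrite subr_ge0 ler_pdivrMr// mulrC.
have [->|xy0] := eqVneq (B x y) 0; first by rewrite expr0n x0 mul0r.
(* [x] is isotropic: the form is affine in the coefficient of [x], and this
   coefficient makes it negative. *)
have := q (- (B y y + 1) / (2 * B x y)); rewrite form_quad// x0.
have -> : (- (B y y + 1) / (2 * B x y)) ^+ 2 * 0 +
   2 * (- (B y y + 1) / (2 * B x y)) * B x y + B y y = -1 by field.
by lra.
Qed.

Lemma form_normD x y : D x -> D y -> nm (x + y) <= nm x + nm y.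
Proof.
move=> Dx Dy.
have Dxy : D (x + y) by rewrite -[x]scale1r; apply: sD.2.
rewrite -(ler_pXn2r (n := 2))// ?nnegrE ?addr_ge0 ?form_norm_ge0//.
rewrite sqrrD !form_normK// -{1 2}[x]scale1r form_quad//.
have := form_cauchy_schwarz Dx Dy; rewrite ler_norml => /andP[_].
by rewrite mulr2n; lra.
Qed.

Lemma form_normZ a x : D x -> nm (a *: x) = `|a| * nm x.
Proof.
move=> Dx; rewrite /form_norm -[a *: x]addr0 form_quad//; last exact: sD.1.
have [Bl _ _] := pB.
have B0 y : D y -> B 0 y = 0.
  move=> Dy; have := Bl (-1) 0 0 y sD.1 sD.1 Dy; rewrite scaler0 addr0; lra.
have -> : B x 0 = 0 by rewrite (let: And3 _ h _ := pB in h)//; [exact: B0|exact: sD.1].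
by rewrite B0 ?mulr0 ?addr0; [rewrite sqrtrM ?sqr_ge0// sqrtr_sqr|exact: sD.1].
Qed.

Lemma form_norm_distr x y : D x -> D y -> `|nm x - nm y| <= nm (x - y).
Proof.
move=> Dx Dy; have Dxy := subspaceB Dx Dy.
have h1 := form_normD Dxy Dy; rewrite subrK in h1.
have h2 := form_normD (subspaceZ (-1) Dxy) Dx.
move: h2; rewrite form_normZ// scaleN1r opprB subrK normrN normr1 mul1r => h2.
by rewrite ler_norml; apply/andP; split; lra.
Qed.

Definition form_cauchy (u : nat -> V) : Prop :=
  forall e : R, 0 < e -> exists N : nat, forall m n,
    (N <= m)%N -> (N <= n)%N -> nm (u m - u n) < e.

(** Riesz representation in the completion of [(D, B)]: a bounded functional is
    the limit of the functionals [B (u n)] of a minimising sequence [u] of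
    [B v v - 2 phi v], which is Cauchy by the parallelogram law. *)
Lemma riesz_sequence (phi : V -> R) C :
  (forall a x y, D x -> D y -> phi (a *: x + y) = a * phi x + phi y) ->
  (forall x, D x -> `|phi x| <= C * nm x) ->
  exists u : nat -> V, [/\ forall n, D (u n), form_cauchy u &
    forall y, D y -> B (u n) y @[n --> \oo] --> phi y].
Proof.
move=> phil phiC; have [Bl Bs Bp] := pB.
pose J v := B v v - 2 * phi v.
have Jge v : D v -> - C ^+ 2 <= J v.
  move=> Dv; rewrite /J -form_normK//.
  have := phiC v Dv; rewrite ler_norml => /andP[_ h].
  by have := sqr_ge0 (nm v - C); nra.
pose m := inf [set J v | v in D].
have mle v : D v -> m <= J v.
  move=> Dv; apply: ge_inf; last by exists v.
  by exists (- C ^+ 2) => _ [w Dw <-]; exact: Jge.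
have uex n : exists v, D v /\ J v < m + n.+1%:R^-1.
  have hi : has_inf [set J v | v in D].
    split; first by exists (J 0), 0 => //; exact: sD.1.
    by exists (- C ^+ 2) => _ [w Dw <-]; exact: Jge.
  have e0 : 0 < n.+1%:R^-1 :> R by rewrite invr_gt0.
  by have [_ [v Dv <-] h] := inf_adherent e0 hi; exists v.
have [u uP] := choice uex; exists u.
have Du n := (uP n).1.
have JD a v w : D v -> D w ->
    J (a *: v + w) = J w + 2 * a * (B w v - phi v) + a ^+ 2 * B v v.
  by move=> Dv Dw; rewrite /J form_quad// phil// (Bs v w)//; ring.
have small (e : R) : 0 < e -> exists N : nat, forall n, (N <= n)%N -> n.+1%:R^-1 < e :> R.
  move=> e0; have := (cvg_seqP _ _).1 (@cvg_harmonic R) e e0.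
  move=> [N hN]; exists N => n /hN; rewrite subr0 /harmonic ger0_norm//.
split=> //.
- move=> e e0; have [|N hN] := small (e ^+ 2 / 4); first by rewrite divr_gt0 ?exprn_gt0.
  exists N => k n Nk Nn.
  rewrite -(ltr_pXn2r (n := 2))// ?nnegrE ?form_norm_ge0 ?(ltW e0)//.
  have Dkn := subspaceB (Du k) (Du n).
  rewrite form_normK//.
  (* Compare [J] at the midpoint of [u k] and [u n] with its infimum. *)
  have := mle _ (sD.2 2^-1 _ _ Dkn (Du n)); rewrite JD//.
  have := JD 1 _ _ Dkn (Du n); rewrite scale1r subrK expr1n mul1r mulr1.
  have := hN _ Nk; have := hN _ Nn; have := (uP k).2; have := (uP n).2.
  set Y := J _; set Z := J _; set W := B _ _ - _.
  move=> h1 h2 h3 h4 h5 h6.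
  have -> : e ^+ 2 = 4 * (e ^+ 2 / 4) by field.
  have E : 2 * 2^-1 * W = W by field.
  have F : 2^-1 ^+ 2 = 4^-1 :> R by field.
  rewrite E F in h6; move: (n.+1%:R^-1) (k.+1%:R^-1) (e ^+ 2 / 4) h1 h2 h3 h4.
  by clearbody m Y Z W => a b c h1 h2 h3 h4; lra.
- move=> y Dy; apply/cvg_seqP => e e0.
  have b0 : 0 < B y y + 1 by rewrite ltr_wpDl// Bp.
  have [|N hN] := small (e ^+ 2 / (B y y + 1)); first by rewrite divr_gt0// exprn_gt0.
  exists N => n Nn.
  set d := B (u n) y - phi y.
  rewrite -(ltr_pXn2r (n := 2))// ?nnegrE// ?(ltW e0)//.
  rewrite real_normK ?num_real//.
  (* The minimiser [- d / B y y] of the quadratic polynomial in the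
     coefficient of [y], shifted to allow [B y y = 0]. *)
  have := mle _ (sD.2 (- d / (B y y + 1)) _ _ Dy (Du n)); rewrite JD// -/d.
  have -> : J (u n) + 2 * (- d / (B y y + 1)) * d + (- d / (B y y + 1)) ^+ 2 * B y y
    = J (u n) - (d ^+ 2 / (B y y + 1)) - d ^+ 2 / (B y y + 1) ^+ 2 by field; rewrite gt_eqF.
  have := (uP n).2; have := hN _ Nn.
  have : 0 <= d ^+ 2 / (B y y + 1) ^+ 2 by rewrite divr_ge0 ?sqr_ge0.
  move=> h1 h2 h3 h4.
  have : d ^+ 2 / (B y y + 1) < e ^+ 2 / (B y y + 1).
    move: (n.+1%:R^-1) (d ^+ 2 / (B y y + 1) ^+ 2) (d ^+ 2 / (B y y + 1))
      (e ^+ 2 / (B y y + 1)) (J (u n)) h1 h2 h3 h4.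
    by clearbody m => *; lra.
  by rewrite ltr_pM2r// invr_gt0.
Qed.

End PositiveForms.

(** * Uniform boundedness by a gliding hump *)

Section GlidingHump.
Context (R : realType) (V : lmodType R).

(** Uniform boundedness for functionals [f n] whose norms are attained at
    vectors [v n] of norm at most [1] and grow fast. The sum of the [v n]
    weighted by [3 ^- n] and suitable signs is built as a Cauchy sequence, so that the lemma applies in
    any space in which such sequences have limits. The signs make the increments
    push the functionals up, and the ratio [1/3] keeps the later increments from
    undoing what step [n] gained. *)
Lemma gliding_hump (D : set V) (p : V -> R) (f : nat -> V -> R) (v : nat -> V) :
  linear_subspace D ->
  (forall x y, D x -> D y -> p (x + y) <= p x + p y) ->
  (forall a x, D x -> p (a *: x) = `|a| * p x) ->
  (forall n a x y, D x -> D y -> f n (a *: x + y) = a * f n x + f n y) ->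
  (forall n x, D x -> `|f n x| <= f n (v n) * p x) ->
  (forall n, D (v n)) -> (forall n, p (v n) <= 1) ->
  (forall n, 2 * n%:R * 3 ^+ n <= f n (v n)) ->
  exists u : nat -> V, [/\ forall n, D (u n),
    forall m n, (m <= n)%N -> p (u n - u m) <= 2 * 3 ^- m &
    forall n m, (n < m)%N -> n%:R <= `|f n (u m)|].
Proof.
move=> sD pD pZ fl fp Dv pv fv.
have t0 n : 0 < 3 ^- n :> R by rewrite invr_gt0 exprn_gt0.
pose u := fix u n := if n is n'.+1 then
  ((if 0 <= f n' (u n') then 1 else -1) * 3 ^- n') *: v n' + u n' else 0.
have uS n : u n.+1 = ((if 0 <= f n (u n) then 1 else -1) * 3 ^- n) *: v n + u n by [].
have Du n : D (u n).
  by elim: n => [|n ih]; [exact: sD.1|rewrite uS; apply: sD.2].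
have p0 : p 0 = 0 by rewrite -(scale0r 0) pZ ?normr0 ?mul0r//; exact: sD.1.
have pu m k : p (u (k + m)%N - u m) <= 3 / 2 * (3 ^- m - 3 ^- (k + m)).
  elim: k => [|k ih]; first by rewrite add0n !subrr p0 mulr0.
  rewrite addSn uS -addrA.
  set a := _ * _; have an : `|a| = 3 ^- (k + m).
    rewrite /a normrM (gtr0_norm (t0 _)).
    by case: ifP => _; rewrite ?normrN normr1 mul1r.
  apply: (le_trans (pD _ _ _ _)).
  - exact: subspaceZ.
  - exact: subspaceB.
  - rewrite pZ// an exprS invfM.
    have := pv (k + m)%N; have := t0 (k + m)%N; move: ih.
    move: (3 ^- (k + m)) (3 ^- m) (p (v _)) (p _) => x y w z; nra.
have pu' m n : (m <= n)%N -> p (u n - u m) <= 3 / 2 * 3 ^- m.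
  move=> mn; have := pu m (n - m)%N; rewrite subnK//.
  have := t0 n; move: (3 ^- n) (3 ^- m) (p _) => x y z; lra.
exists u; split=> //.
- move=> m n mn; have := pu' m n mn; have := t0 m.
  move: (3 ^- m) (p _) => x y; lra.
- move=> n m nm.
  have fv0 : 0 <= f n (v n) by apply: le_trans (fv n); rewrite !mulr_ge0// exprn_ge0.
  have h1 : `|f n (u n.+1)| = `|f n (u n)| + 3 ^- n * f n (v n).
    rewrite uS fl//; case: ifPn => [h|]; last rewrite -ltNge => h.
      by rewrite mul1r !ger0_norm ?addr_ge0// ?mulr_ge0// 1?ltW//; ring.
    rewrite !ltr0_norm//; first by ring.
    rewrite -[X in _ < X]addr0 ler_ltD// mulN1r mulNr oppr_le0 mulr_ge0//.
  have h2 := fp n _ (subspaceB sD (Du m) (Du n.+1)).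
  have h3 := pu' _ _ nm.
  have fB : f n (u m - u n.+1) = f n (u m) - f n (u n.+1).
    by rewrite addrC -scaleN1r fl// mulN1r addrC.
  have h4 : f n (v n) * p (u m - u n.+1) <= f n (v n) * (3 / 2 * 3 ^- n.+1).
    by rewrite ler_wpM2l.
  have h5 : n%:R <= 3 ^- n * f n (v n) / 2.
    rewrite ler_pdivlMr// ler_pdivlMl ?exprn_gt0//.
    by rewrite (_ : _ * _ = 2 * n%:R * 3 ^+ n) ?fv//; ring.
  have h6 : 3 ^- n.+1 = 3 ^- n / 3 :> R by rewrite exprS invfM mulrC.
  have h7 := lerB_dist (f n (u n.+1)) (f n (u m)).
  rewrite distrC -fB h1 in h7; rewrite h6 in h4.
  have := normr_ge0 (f n (u n)).
  have h8 : f n (v n) * (3 / 2 * (3 ^- n / 3)) = 3 ^- n * f n (v n) / 2 by field.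
  by rewrite h8 in h4; lra.
Qed.

End GlidingHump.

(** * The norm of the dual *)

Section DualNorm.
Context (R : realType) (E : normedModType R).

Local Notation dualE := (@dual R E : set (E -> R^o)).

Lemma dual_subspace : linear_subspace dualE.
Proof.
split.
  split; first by move=> a x y /=; rewrite mulr0 addr0.
  by move=> x; exact: cst_continuous.
move=> a x y dx dy.
have [C C0 xC] := dual_bounded dx; have [C' C'0 yC] := dual_bounded dy.
have l : scalar (a *: x + y).
  move=> b e1 e2 /=.
  rewrite -[(a *: x + y) _]/(a * x _ + y _) -[(a *: x + y) e1]/(a * x _ + y _).
  by rewrite -[(a *: x + y) e2]/(a * x _ + y _) dx.1 dy.1 /=; ring.
split=> //; apply: (scalar_bounded_continuous (C := `|a| * C + C')) => // e.
rewrite -[(a *: x + y) e]/(a * x _ + y _) mulrDl (le_trans (ler_normD _ _))//.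
by rewrite lerD// normrM -mulrA ler_wpM2l.
Qed.

Definition dual_norm (x : E -> R) : R := sup [set `|x e| | e in [set e | `|e| <= 1]].

Lemma dual_norm_le (x : E -> R) C : 0 <= C -> (forall e, `|x e| <= C * `|e|) ->
  dual_norm x <= C.
Proof.
move=> C0 xC; apply: ge_sup; first by exists `|x 0|, 0 => //=; rewrite normr0.
move=> _ [e /= e1 <-]; rewrite (le_trans (xC e))//.
by rewrite -[leRHS]mulr1 ler_wpM2l.
Qed.

Lemma le_dual_norm (x : E -> R) e : dual x -> `|x e| <= dual_norm x * `|e|.
Proof.
move=> dx; have [C C0 xC] := dual_bounded dx.
have [->|e0] := eqVneq e 0.
  by rewrite (scalar_fun0 dx.1) !normr0 mulr0.
have e1 : 0 < `|e| by rewrite normr_gt0.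
rewrite -ler_pdivrMr//; apply: ub_le_sup.
  exists C => _ [k /= k1 <-]; rewrite (le_trans (xC k))//.
  by rewrite -[leRHS]mulr1 ler_wpM2l// ltW.
exists (`|e|^-1 *: e); first by rewrite /= normrZ normfV normr_id mulVf// gt_eqF.
by rewrite (scalar_funZ dx.1) normrM normfV normr_id mulrC.
Qed.

Lemma dual_norm_ge0 (x : E -> R) : dual x -> 0 <= dual_norm x.
Proof.
move=> dx; have := le_trans (normr_ge0 _) (le_dual_norm 0 dx).
rewrite normr0 mulr0 => _; apply: (@le_trans _ _ `|x 0|) => //.
apply: ub_le_sup; last by exists 0 => //=; rewrite normr0.
have [C C0 xC] := dual_bounded dx.
exists C => _ [k /= k1 <-]; rewrite (le_trans (xC k))//.
by rewrite -[leRHS]mulr1 ler_wpM2l// ltW.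
Qed.

Lemma dual_normD (x y : E -> R^o) : dual x -> dual y ->
  dual_norm (x + y) <= dual_norm x + dual_norm y.
Proof.
move=> dx dy; apply: dual_norm_le => [|e]; first by rewrite addr_ge0 ?dual_norm_ge0.
rewrite -[(x + y) e]/(x e + y e) mulrDl (le_trans (ler_normD _ _))//.
by rewrite lerD// le_dual_norm.
Qed.

Lemma dual_normZ a (x : E -> R^o) : dual x -> dual_norm (a *: x) = `|a| * dual_norm x.
Proof.
have le b (z : E -> R^o) : dual z -> dual_norm (b *: z) <= `|b| * dual_norm z.
  move=> dz; apply: dual_norm_le => [|e]; first by rewrite mulr_ge0// dual_norm_ge0.
  by rewrite -[(b *: z) e]/(b * z e) normrM -mulrA ler_wpM2l// le_dual_norm.
move=> dx; apply/eqP; rewrite eq_le le//=.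
have [->|a0] := eqVneq a 0.
  rewrite normr0 mul0r dual_norm_ge0// scale0r; exact: dual_subspace.1.
have dax : dual (a *: x) by apply: (subspaceZ dual_subspace).
have := le a^-1 _ dax; rewrite scalerA mulVf// scale1r normfV ler_pdivlMl//.
by rewrite normr_gt0.
Qed.

Lemma dual_complete (u : nat -> E -> R^o) : (forall n, dual (u n)) ->
  (forall m n, (m <= n)%N -> dual_norm (u n - u m) <= 2 * 3 ^- m) ->
  exists2 l : E -> R, dual l & forall e, u n e @[n --> \oo] --> l e.
Proof.
move=> du uc.
have ud m n e : (m <= n)%N -> `|u n e - u m e| <= 2 * 3 ^- m * `|e|.
  move=> mn; have d := subspaceB dual_subspace (du n) (du m).
  by rewrite (le_trans (le_dual_norm e d))// ler_wpM2r// uc.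
have small (c d : R) : 0 < d -> 0 <= c -> exists N, 2 * 3 ^- N * c < d.
  move=> d0 c0; have := @cvg_geometric R (2 * c) 3^-1.
  rewrite ger0_norm ?invr_ge0// invf_lt1// ltr1n => /(_ isT)/cvg_seqP/(_ _ d0)[N].
  move=> /(_ N (leqnn N)); rewrite subr0 /geometric ger0_norm ?mulr_ge0// exprVn => h.
  by exists N; rewrite mulrAC.
have ucv e : exists l : R, u n e @[n --> \oo] --> l.
  apply: (@cauchy_seq_cvg R R^o) => d d0.
  have [N hN] := small `|e| (d / 2) (divr_gt0 d0 (ltr0n _ 2)) (normr_ge0 _).
  exists N => m n Nm Nn.
  have := ud _ _ e Nm; have := ud _ _ e Nn; have := ler_distD (u N e) (u m e) (u n e).
  rewrite (distrC (u N e) (u n e)); lra.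
have [l lP] := choice ucv; exists l => //.
have ll : scalar l.
  move=> a x y; apply/esym; apply: (@cvg_unique _ (@Rhausdorff R)) (lP _).
  rewrite (_ : (fun n => u n (a *: x + y)) = (fun n => a * u n x + u n y)).
    by apply: cvgD => //; apply: cvgMr => //; exact: lP.
  by apply/funext => n; rewrite (du n).1.
split=> //; apply: (scalar_bounded_continuous (C := 2 + dual_norm (u 0%N))) => // e.
have h : `|l e| - dual_norm (u 0%N) * `|e| <= 2 * `|e|.
  apply: (@cvg_seq_le R (fun n => `|u n e| - dual_norm (u 0%N) * `|e|) _ _ 0%N).
    by apply: cvgB; [apply: cvg_norm; exact: lP|exact: cvg_cst].
  move=> n _; have := ud _ _ e (leq0n n); rewrite expr0 invr1 mulr1.
  have := le_dual_norm e (du 0%N); have := lerB_dist (u n e) (u 0%N e); lra.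
by rewrite mulrDl; lra.
Qed.

End DualNorm.

(** * Reproducing kernel Hilbert spaces *)

Section ReproducingKernel.
Context (R : realType) (E : completeNormedModType R) (A : (E -> R) -> E).

Local Notation dualE := (@dual R E : set (E -> R^o)).

Definition positive_symmetric : Prop :=
  (forall x y : E -> R, dual x -> dual y -> x (A y) = y (A x)) /\
  (forall x : E -> R, dual x -> 0 <= x (A x)).

Hypothesis psA : positive_symmetric.

Local Notation form := (fun x y : E -> R^o => (x (A y) : R)).
Local Notation nm := (range_norm A).

Lemma operator_form : positive_form dualE form.
Proof. by split=> //; [exact: psA.1|exact: psA.2]. Qed.

Lemma range_norm_ge0 x : 0 <= nm x.
Proof. exact: sqrtr_ge0. Qed.

Lemma range_normK x : dual x -> nm x ^+ 2 = x (A x).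
Proof. exact: (form_normK operator_form). Qed.

Lemma operator_cauchy_schwarz x y : dual x -> dual y -> `|x (A y)| <= nm x * nm y.
Proof. exact: (form_cauchy_schwarz (@dual_subspace R E) operator_form). Qed.

(** The Hellinger-Toeplitz theorem: by symmetry [|u (A x)| <= |A u| |x|], so the
    images of the unit ball are bounded at every [u] of the dual, and uniform
    boundedness in the dual bounds their norms. *)
Lemma symmetric_bounded : exists2 K, 0 <= K &
  forall x, dual x -> `|A x| <= K * dual_norm x.
Proof.
apply: contrapT => nK.
have xex (n : nat) : exists x, dual x /\ 2 * n%:R * 3 ^+ n * dual_norm x < `|A x|.
  apply: contrapT => nx; apply: nK; exists (2 * n%:R * 3 ^+ n).
    by rewrite !mulr_ge0// exprn_ge0.
  by move=> x dx; rewrite leNgt; apply/negP => h; apply: nx; exists x.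
have [x xP] := choice xex.
have dx n : dual (x n) := (xP n).1.
have Ax0 n : 0 < `|A (x n)|.
  by apply: le_lt_trans (xP n).2; rewrite !mulr_ge0// ?exprn_ge0// dual_norm_ge0.
have [v vP] := choice (fun n => norming_functional (A (x n))).
have dv n : dual (v n) by have [] := vP n.
have vA n : v n (A (x n)) = `|A (x n)| by have [] := vP n.
have x0 n : 0 < dual_norm (x n).
  rewrite lt_def dual_norm_ge0// andbT; apply/eqP => xn0.
  have : `|x n (A (v n))| <= 0 by rewrite (le_trans (le_dual_norm _ (dx n)))// xn0 mul0r.
  by rewrite (psA.1 _ _ (dx n) (dv n)) vA normr_id leNgt Ax0.
pose f n (u : E -> R^o) : R := u (A (x n)) / dual_norm (x n).
have fv n : f n (v n) = `|A (x n)| / dual_norm (x n) by rewrite /f vA.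
have [||||||| |u [du uc uf]] := @gliding_hump R (E -> R^o) dualE (@dual_norm R E) f v.
- exact: dual_subspace.
- exact: dual_normD.
- exact: dual_normZ.
- by move=> n a y z _ _; rewrite /f -[(a *: y + z) _]/(a * y _ + z _) mulrDl mulrA.
- move=> n y dy; rewrite fv /f normrM normfV (gtr0_norm (x0 n)) mulrAC.
  by rewrite ler_wpM2r ?invr_ge0 ?(ltW (x0 n))// mulrC le_dual_norm.
- exact: dv.
- move=> n; apply: dual_norm_le => // e; rewrite mul1r.
  by have [_ h _] := vP n; exact: h.
- by move=> n; rewrite fv ler_pdivlMr// ltW// (xP n).2.
have [l dl ul] := dual_complete du uc.
pose N := Num.bound `|A l|.
have : `|A l| < N%:R by exact: archi_boundP.
rewrite ltNge => /negP; apply.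
have : N%:R <= `|f N l|.
  have cv : (- `|f N (u m)|) @[m --> \oo] --> - `|f N l|.
    apply: cvgN; apply: cvg_norm; apply: cvgMl; exact: ul.
  by rewrite -lerN2; apply: (cvg_seq_le (N := N.+1) cv) => m Nm; rewrite lerN2 uf.
move/le_trans; apply; rewrite /f normrM normfV (gtr0_norm (x0 _)) ler_pdivrMr//.
by rewrite (psA.1 _ _ dl (dx N)) mulrC le_dual_norm.
Qed.

Lemma range_norm_bounded : exists2 K, 0 <= K &
  forall x, dual x -> nm x <= K * dual_norm x.
Proof.
have [K K0 AK] := symmetric_bounded.
exists (Num.sqrt K); first exact: sqrtr_ge0.
move=> x dx; have x0 := dual_norm_ge0 dx.
rewrite -(ler_pXn2r (n := 2))// ?nnegrE ?mulr_ge0 ?sqrtr_ge0//.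
rewrite range_normK// exprMn sqr_sqrtr//.
apply: (le_trans (ler_norm _)); apply: (le_trans (le_dual_norm _ dx)).
by apply: (le_trans (ler_wpM2l x0 (AK x dx))); rewrite mulrCA expr2.
Qed.

(** The norm of [A x - A y] is attained at a unit functional, where the
    Cauchy-Schwarz inequality bounds it by a multiple of [nm (x - y)]. *)
Lemma range_cauchy_cvg (u : nat -> E -> R^o) : (forall n, dual (u n)) ->
  form_cauchy form u -> exists h : E, A (u n) @[n --> \oo] --> h.
Proof.
move=> du uc; have [K K0 nK] := range_norm_bounded.
apply: cauchy_seq_cvg => e e0; have K1 : 0 < K + 1 by rewrite ltr_wpDl.
have [N hN] := uc (e / (K + 1)) (divr_gt0 e0 K1).
exists N => m n Nm Nn.
have [y [dy yb yA]] := norming_functional (A (u m) - A (u n)).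
have dB := subspaceB (@dual_subspace R E) (du m) (du n).
rewrite -yA (scalar_funB dy.1).
rewrite (psA.1 _ _ dy (du m)) (psA.1 _ _ dy (du n)).
apply: (le_lt_trans (ler_norm ((u m - u n) (A y)))).
apply: (le_lt_trans (operator_cauchy_schwarz dB dy)).
have y1 : nm y <= K + 1.
  rewrite (le_trans (nK y dy))// -[leLHS]addr0 lerD// -[leRHS]mulr1 ler_wpM2l//.
  by apply: dual_norm_le => // z; rewrite mul1r.
have := hN _ _ Nm Nn; rewrite ltr_pdivlMr//; apply: le_lt_trans.
by rewrite ler_wpM2l// range_norm_ge0.
Qed.

Lemma rkhs_repr_norm_cvg h u : rkhs_repr A h u ->
  nm (u n) @[n --> \oo] --> lim (nm (u n) @[n --> \oo]).
Proof.
move=> [du uc _]; suff : exists l : R^o, nm (u n) @[n --> \oo] --> l.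
  by move=> /cvg_ex.
apply: (@cauchy_seq_cvg R R^o) => e e0.
have [N hN] := uc e e0; exists N => m n Nm Nn.
apply: le_lt_trans (hN _ _ Nm Nn).
exact: (form_norm_distr (@dual_subspace R E) operator_form (du m) (du n)).
Qed.

Lemma rkhs_repr_bound h u (l : R) : rkhs_repr A h u -> nm (u n) @[n --> \oo] --> l ->
  forall y, dual y -> `|y h| <= l * nm y.
Proof.
move=> [du uc uh] ul y dy; rewrite -subr_le0.
apply: (@cvg_seq_le R (fun n => `|y (A (u n))| - nm (u n) * nm y) _ _ 0%N).
  apply: cvgB; last exact: cvgMl.
  by apply: cvg_norm; apply: (cvg_comp _ _ uh); exact: dy.2.
move=> n _; rewrite subr_le0 (psA.1 _ _ dy (du n)).
exact: operator_cauchy_schwarz.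
Qed.

Lemma rkhs_repr_norm_le h u (l C : R) : rkhs_repr A h u ->
  nm (u n) @[n --> \oo] --> l -> 0 <= C ->
  (forall y, dual y -> `|y h| <= C * nm y) -> l <= C.
Proof.
move=> [du uc uh] ul C0 hC; apply/ler_addgt0Pr => e e0.
have [N hN] := uc e e0; apply: (cvg_seq_le (N := N) ul) => m Nm.
have [n0|n0] := eqVneq (nm (u m)) 0; first by rewrite n0 addr_ge0// ltW.
have np : 0 < nm (u m) by rewrite lt_def n0 range_norm_ge0.
suff : nm (u m) ^+ 2 - nm (u m) * e <= u m h.
  have := hC _ (du m); rewrite ler_norml => /andP[_ h1] h2.
  have := le_trans h2 h1; rewrite expr2 -mulrBr mulrC ler_pM2r//; lra.
rewrite -lerN2.
have cv : (- u m (A (u n))) @[n --> \oo] --> - u m h.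
  by apply: cvgN; apply: (cvg_comp _ _ uh); exact: (du m).2.
apply: (cvg_seq_le (N := N) cv) => n Nn; rewrite lerN2.
have dB := subspaceB (@dual_subspace R E) (du m) (du n).
have : `|u m (A (u m)) - u n (A (u m))| <= nm (u m \- u n) * nm (u m).
  exact: (operator_cauchy_schwarz dB (du m)).
rewrite -(range_normK (du m)) (psA.1 _ _ (du m) (du n)) => h1.
have h2 : nm (u m \- u n) * nm (u m) <= e * nm (u m).
  by apply: ler_wpM2r; [exact: range_norm_ge0|exact: ltW (hN _ _ Nm Nn)].
by have := ler_norm (nm (u m) ^+ 2 - u n (A (u m))); lra.
Qed.

(** With [rkhs_bounded], this tests membership and norm in the reproducing kernel
    Hilbert space on functionals: comparing two such spaces reduces to comparing
    the seminorms [x |-> <A x, x>^(1/2)] on the dual. *)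
Lemma rkhs_normP h : rkhs A h ->
  0 <= rkhs_norm A h /\ forall y, dual y -> `|y h| <= rkhs_norm A h * nm y.
Proof.
move=> hA; have := xgetPex point hA; rewrite -/(get (rkhs_repr A h)) => r.
have cv := rkhs_repr_norm_cvg r; split; last exact: (rkhs_repr_bound r cv).
rewrite -oppr_le0; apply: (@cvg_seq_le R (fun n => - nm (get (rkhs_repr A h) n)) _ _ 0%N).
  exact: cvgN.
by move=> n _; rewrite oppr_le0 range_norm_ge0.
Qed.

(** A Riesz sequence of the evaluation at [h] represents [h]. *)
Lemma rkhs_bounded h C : 0 <= C -> (forall y, dual y -> `|y h| <= C * nm y) ->
  rkhs A h /\ rkhs_norm A h <= C.
Proof.
move=> C0 hC.
have hA : rkhs A h.
  have [||u [du uc uB]] := riesz_sequence (@dual_subspace R E) operator_form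
    (phi := fun y => y h) (C := C) _ _; [by []|exact: hC|].
  have [k uk] := range_cauchy_cvg du uc; exists u; split=> //.
  suff -> : h = k by [].
  apply: dual_separates => y dy.
  apply: (@cvg_unique _ (@Rhausdorff R) (u n (A y) @[n --> \oo])); first exact: uB.
  rewrite (_ : (fun n => u n (A y)) = (fun n => y (A (u n)))).
    by apply: (cvg_comp _ _ uk); exact: dy.2.
  by apply/funext => n; rewrite (psA.1 _ _ dy (du n)).
split=> //.
have := xgetPex point hA; rewrite -/(get (rkhs_repr A h)) => r.
exact: (rkhs_repr_norm_le r (rkhs_repr_norm_cvg r) C0 hC).
Qed.

Lemma rkhs_range x : dual x -> rkhs A (A x) /\ rkhs_norm A (A x) <= nm x.
Proof.
move=> dx; apply: rkhs_bounded => [|y dy]; first exact: range_norm_ge0.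
by rewrite mulrC operator_cauchy_schwarz.
Qed.

End ReproducingKernel.

(** * Hilbert spaces *)

Section Hilbert.
Context (R : realType) (H : completeNormedModType R).
Context (ip : {dot H for (idfun : R -> R)}) (hilbertH : induces_norm ip).

Lemma ipC u v : ip u v = ip v u.
Proof. by rewrite hermC expr0 mul1r. Qed.

Lemma ipl a u v w : ip (a *: u + v) w = a * ip u w + ip v w.
Proof. by rewrite linearDl linearZl_LR. Qed.

Lemma ipr a u v w : ip w (a *: u + v) = a * ip w u + ip w v.
Proof. by rewrite ipC ipl !(ipC w). Qed.

Lemma ipDr u v w : ip w (u + v) = ip w u + ip w v.
Proof. by rewrite -[u]scale1r ipr mul1r scale1r. Qed.

Lemma ipDl u v w : ip (u + v) w = ip u w + ip v w.
Proof. by rewrite !(ipC _ w) ipDr. Qed.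

Lemma ipBr u v w : ip w (u - v) = ip w u - ip w v.
Proof. by rewrite addrC -scaleN1r ipr mulN1r addrC. Qed.

Lemma ipBl u v w : ip (u - v) w = ip u w - ip v w.
Proof. by rewrite !(ipC _ w) ipBr. Qed.

Lemma ip_form : positive_form [set: H] (fun u v => ip u v).
Proof.
split; first by move=> a u v w _ _ _; exact: ipl.
  by move=> u v _ _; exact: ipC.
by move=> u _; rewrite -hilbertH exprn_ge0.
Qed.

Lemma setT_subspace : linear_subspace [set: H].
Proof. by []. Qed.

Lemma form_norm_ip u : form_norm (fun u v => ip u v) u = `|u|.
Proof. by rewrite /form_norm -hilbertH sqrtr_sqr normr_id. Qed.

Lemma ip_cauchy_schwarz u v : `|ip u v| <= `|u| * `|v|.
Proof.
by rewrite -!form_norm_ip; apply: (form_cauchy_schwarz setT_subspace ip_form).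
Qed.

Lemma ip_le u v : ip u v <= `|u| * `|v|.
Proof. exact: le_trans (ler_norm _) (ip_cauchy_schwarz u v). Qed.

Lemma ip_scalarl v : scalar (fun u => ip u v).
Proof. by move=> a x y; rewrite ipl. Qed.

Lemma ip_cvg (u : nat -> H) g v : u n @[n --> \oo] --> g ->
  ip v (u n) @[n --> \oo] --> ip v g.
Proof.
move=> /cvg_seqP ug; apply/cvg_seqP => e e0.
have v0 : 0 < `|v| + 1 by rewrite ltr_wpDl.
have [N hN] := ug (e / (`|v| + 1)) (divr_gt0 e0 v0); exists N => n Nn.
rewrite -ipBr (le_lt_trans (ip_cauchy_schwarz _ _))//.
have := hN n Nn; rewrite ltr_pdivlMr// mulrC; apply: le_lt_trans.
by rewrite ler_wpM2r// lerDl.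
Qed.

(** One representation theorem serves the adjoint ([j] the identity), density
    of subspaces ([D] the subspace) and membership in the range of an injection
    ([j] its adjoint). *)
Lemma riesz_through (V : lmodType R) (D : set V) (j : V -> H) (phi : V -> R) C :
  linear_subspace D ->
  (forall a x y, D x -> D y -> j (a *: x + y) = a *: j x + j y) ->
  (forall a x y, D x -> D y -> phi (a *: x + y) = a * phi x + phi y) ->
  (forall x, D x -> `|phi x| <= C * `|j x|) -> 0 <= C ->
  exists g : H, [/\ `|g| <= C, forall x, D x -> phi x = ip (j x) g &
    forall e : R, 0 < e -> exists2 x, D x & `|j x - g| < e].
Proof.
move=> sD jl phil phiC C0.
pose B x y := ip (j x) (j y).
have nB x : form_norm B x = `|j x| by rewrite /form_norm /B -hilbertH sqrtr_sqr normr_id.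
have pB : positive_form D B.
  split=> [a x y z Dx Dy Dz|x y Dx Dy|x Dx]; rewrite /B.
  - by rewrite jl// ipl.
  - exact: ipC.
  - by rewrite -hilbertH exprn_ge0.
have jB x y : D x -> D y -> j (x - y) = j x - j y.
  by move=> Dx Dy; rewrite addrC -scaleN1r jl// scaleN1r addrC.
have [|u [Du uc uphi]] := riesz_sequence sD pB (phi := phi) (C := C) phil.
  by move=> x Dx; rewrite nB phiC.
have [|g ug] := @cauchy_seq_cvg R H (j \o u).
  move=> e e0; have [N hN] := uc e e0; exists N => m n Nm Nn.
  by have := hN m n Nm Nn; rewrite nB jB.
have phig x : D x -> phi x = ip (j x) g.
  move=> Dx; apply: (@cvg_unique _ (@Rhausdorff R) (B (u n) x @[n --> \oo])).
    exact: uphi.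
  rewrite (_ : (fun n => B (u n) x) = (fun n => ip (j x) (j (u n)))).
    exact: ip_cvg ug.
  by apply/funext => n; rewrite /B ipC.
exists g; split=> //.
- have : `|g| * `|g| <= C * `|g|.
    rewrite -expr2 hilbertH -subr_le0.
    apply: (@cvg_seq_le R (fun n => ip g (j (u n)) - C * `|j (u n)|) _ _ 0%N).
      apply: cvgB; first exact: ip_cvg ug.
      by apply: cvgMr; apply: cvg_norm; exact: ug.
    move=> n _; rewrite subr_le0 ipC -phig//.
    exact: le_trans (ler_norm _) (phiC _ (Du n)).
  have [->|g0] := eqVneq g 0; first by rewrite normr0.
  by rewrite ler_pM2r// normr_gt0.
- move=> e e0; have [N hN] := (cvg_seqP _ _).1 ug e e0.
  by exists (u N) => //; exact: hN.
Qed.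

(** The vector representing [ip ^~ g] on [D] differs from [g] by a vector
    orthogonal to [D]. *)
Lemma subspace_approx (D : set H) : linear_subspace D ->
  (forall g, (forall x, D x -> ip x g = 0) -> g = 0) ->
  forall g e, 0 < e -> exists2 x, D x & `|x - g| < e.
Proof.
move=> sD Dorth g e e0.
have [||||k [_ kg kD]] := @riesz_through H D idfun (fun x => ip x g) `|g| sD.
- by [].
- by move=> a x y _ _; rewrite ipl.
- by move=> x _; rewrite mulrC ip_cauchy_schwarz.
- by [].
have <- : k = g.
  by apply: subr0_eq; apply: Dorth => x Dx; rewrite ipBr -kg//= subrr.
exact: kD.
Qed.

Lemma rieszP (phi : H -> R) C : scalar phi -> (forall k, `|phi k| <= C * `|k|) ->
  forall k, phi k = ip k (riesz ip phi).
Proof.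
move=> lphi phiC.
have [C0|C0] := leP 0 C; last first.
  have phi0 k : phi k = 0.
    apply/eqP; rewrite -normr_le0 (le_trans (phiC k))// mulr_le0_ge0// ltW//.
  apply: (@xgetPex _ point [set h | forall k, phi k = ip k h]).
  by exists 0 => k; rewrite phi0 -(subrr k) ipBr subrr.
apply: (@xgetPex _ point [set h | forall k, phi k = ip k h]).
have [g [_ gphi _]] := @riesz_through H setT idfun phi C setT_subspace
  (fun _ _ _ _ _ => erefl) (fun a x y _ _ => lphi a x y) (fun k _ => phiC k) C0.
by exists g => k; exact: gphi.
Qed.

Definition adjoint (L : H -> H) (h : H) : H := riesz ip (fun k => ip (L k) h).

Lemma ip_ext u v : (forall k, ip k u = ip k v) -> u = v.
Proof.
move=> h; apply/eqP; rewrite -subr_eq0 -normr_eq0 -sqrf_eq0 hilbertH.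
by rewrite ipBr h subrr.
Qed.

Section Adjoint.
Context (L : {linear H -> H}) (M : R) (LM : forall k, `|L k| <= M * `|k|).

Lemma adjointP k h : ip (L k) h = ip k (adjoint L h).
Proof.
apply: (@rieszP (fun k => ip (L k) h) (M * `|h|)).
  by move=> a x y; rewrite linearP ipl.
move=> x; rewrite (le_trans (ip_cauchy_schwarz _ _))//.
by rewrite mulrAC ler_wpM2r.
Qed.

Lemma adjoint_linear : linear (adjoint L).
Proof.
by move=> a x y; apply: ip_ext => k; rewrite ipr -!adjointP ipr.
Qed.

Lemma adjoint_bound h : `|adjoint L h| <= M * `|h|.
Proof.
have [->|n0] := eqVneq `|adjoint L h| 0.
  exact: le_trans (normr_ge0 _) (LM h).
have np : 0 < `|adjoint L h| by rewrite lt_def n0/=.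
rewrite -(ler_pM2l np) -expr2 hilbertH -adjointP (le_trans (ip_le _ _))//.
by rewrite mulrA (mulrC _ M) ler_wpM2r.
Qed.

Lemma adjoint_bound_inv M' : (forall h, `|adjoint L h| <= M' * `|h|) ->
  forall h, `|L h| <= M' * `|h|.
Proof.
move=> aM h; have [->|n0] := eqVneq `|L h| 0.
  exact: le_trans (normr_ge0 _) (aM h).
have np : 0 < `|L h| by rewrite lt_def n0/=.
rewrite -(ler_pM2l np) -expr2 hilbertH adjointP (le_trans (ip_le _ _))//.
apply: (le_trans (ler_wpM2l (normr_ge0 h) (aM (L h)))).
by rewrite mulrCA [leRHS]mulrCA (mulrC `|h|).
Qed.

End Adjoint.

End Hilbert.

(** * Integrals of continuous functions *)

Section ContinuousIntegrals.
Context (R : realType).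

Notation mu := (@lebesgue_measure R).

Definition itv_integral (f : R -> R) (t : R) : R := \int[mu]_(s in `[0, t]) f s.

Lemma continuous_integrable (f : R -> R) a b : continuous f ->
  mu.-integrable `[a, b] (EFin \o f).
Proof.
move=> cf; apply: continuous_compact_integrable; first exact: segment_compact.
exact: continuous_subspaceT.
Qed.

Lemma itv_integral_lin (f g : R -> R) a t : continuous f -> continuous g ->
  itv_integral (fun s => a * f s + g s) t = a * itv_integral f t + itv_integral g t.
Proof.
move=> cf cg; rewrite /itv_integral RintegralD//; last exact: continuous_integrable.
  by rewrite RintegralZl//; exact: continuous_integrable.
by apply: (@continuous_integrable (fun s => a * f s)) => x; apply: cvgMr; exact: cf.
Qed.

Lemma itv_integralZ (f : R -> R) a t : continuous f ->
  itv_integral (fun s => a * f s) t = a * itv_integral f t.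
Proof. by move=> cf; rewrite /itv_integral RintegralZl//; exact: continuous_integrable. Qed.

Lemma itv_integral_le (f g : R -> R) t : continuous f -> continuous g ->
  (forall s, 0 <= s <= t -> f s <= g s) -> itv_integral f t <= itv_integral g t.
Proof.
move=> cf cg fg; apply: le_Rintegral => [//|||x /=]; [exact: continuous_integrable..|].
by rewrite in_itv; exact: fg.
Qed.

Lemma itv_integral_eq (f g : R -> R) t : (forall s, 0 <= s <= t -> f s = g s) ->
  itv_integral f t = itv_integral g t.
Proof.
by move=> fg; apply: eq_Rintegral => x; rewrite inE/= in_itv/=; exact: fg.
Qed.

Lemma itv_integral_cst c t : 0 <= t -> itv_integral (fun=> c) t = c * t.
Proof.
move=> t0; rewrite /itv_integral Rintegral_cst//.
congr (_ * _); rewrite [X in fine X](_ : _ = t%:E)//.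
rewrite [LHS](lebesgue_measure_itv `[0, t])/= lte_fin.
case: ltgtP t0 => // [t0 _|<- _]; last by [].
by rewrite sube0.
Qed.

Lemma itv_integral_ge0 (f : R -> R) t : (forall s, 0 <= s <= t -> 0 <= f s) ->
  0 <= itv_integral f t.
Proof.
by move=> f0; apply: Rintegral_ge0 => x /=; rewrite in_itv; exact: f0.
Qed.

Lemma itv_integral_bound (f : R -> R) c t : continuous f -> 0 <= t ->
  (forall s, 0 <= s <= t -> `|f s| <= c) -> `|itv_integral f t| <= c * t.
Proof.
move=> cf t0 fc; rewrite -(itv_integral_cst c t0) ler_norml; apply/andP; split.
  rewrite itv_integral_cst// -mulNr -itv_integral_cst//.
  apply: itv_integral_le => //; first by move=> x; exact: cvg_cst.
  by move=> s /fc; rewrite ler_norml => /andP[].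
apply: itv_integral_le => //; first by move=> x; exact: cvg_cst.
by move=> s /fc; rewrite ler_norml => /andP[].
Qed.

Lemma itv_integralD (f : R -> R) r t : continuous f -> 0 <= r -> 0 <= t ->
  itv_integral f (r + t) = itv_integral f r + itv_integral (fun s => f (s + r)) t.
Proof.
move=> cf r0 t0; apply/esym/eqP; rewrite addrC eq_sym -subr_eq /itv_integral.
apply/eqP.
rewrite (@Rintegral_itvB R f (BLeft 0) (BRight (r + t)) r); last 3 first.
- exact: continuous_integrable.
- by rewrite bnd_simp.
- by rewrite bnd_simp lerDl.
rewrite Rintegral_itv_obnd_cbnd; last first.
  apply: (@integrableS _ _ _ mu `[r, r + t]) => //; last exact: continuous_integrable.
  exact: subset_itv_oc_cc.
have dF (x : R) : is_derive x 1 (fun s : R => s + r) 1.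
  by rewrite -[X in is_derive _ _ _ X]addr0; apply: (@is_deriveD _ _ _ id (cst r)).
have F1 : derive1 (fun s : R => s + r) = cst 1.
  by apply/funext => x; rewrite derive1E derive_val.
have cF : continuous (fun s : R => s + r).
  by move=> x; apply: cvgD; [exact: cvg_id|exact: cvg_cst].
have := @integration_by_substitution_increasing R (fun s => s + r) f 0 t t0.
rewrite add0r (addrC t) F1 /Rintegral => ->.
- by congr fine; apply: eq_integral => x _ /=; rewrite mulr1.
- by move=> x y _ _ xy /=; rewrite ltrD2r.
- by move=> x _; exact: cvg_cst.
- exact: is_cvg_cst.
- exact: is_cvg_cst.
- split; first by move=> x _; have [] := dF x.
    by apply: cvg_at_right_filter; exact: cF.
  by apply: cvg_at_left_filter; exact: cF.
- exact: continuous_subspaceT.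
Qed.

Lemma uniform_continuity (E : normedModType R) (F : R -> E) t : continuous F ->
  forall e : R, 0 < e -> exists2 d : R, 0 < d &
    forall r s, 0 <= r <= t -> `|r - s| < d -> `|F r - F s| < e.
Proof.
move=> cF e e0.
have := (compact_near_coveringP _).1 (@segment_compact R 0 t) R (0^'+)
  (fun d x => forall s, `|x - s| < d -> `|F x - F s| < e) _.
case=> [x _|d /= d0 dP].
  have /cvgrPdist_lt/(_ (e / 2) (divr_gt0 e0 (ltr0n _ 2))) := cF x.
  move=> /nbhs_ballP[a /= a0 aP].
  exists (ball x (a / 2), [set d | 0 < d < a / 2]) => /=.
    split; first by apply: nbhsx_ballx; rewrite divr_gt0.
    exists (a / 2); first by rewrite /= divr_gt0.
    by move=> d /=; rewrite sub0r normrN => h d0; rewrite d0 (le_lt_trans (ler_norm _)).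
  move=> [y d] /= []; rewrite -ball_normE /= => xy /andP[d0 da] s ys.
  have h1 : `|F x - F y| < e / 2.
    by apply: aP; rewrite -ball_normE /=; lra.
  have h2 : `|F x - F s| < e / 2.
    apply: aP; rewrite -ball_normE /=.
    apply: (le_lt_trans (ler_distD y x s)); rewrite [ltRHS]splitr ltrD//.
    exact: lt_trans ys da.
  have := ler_distD (F x) (F y) (F s); rewrite (distrC (F y) (F x)); lra.
exists (d / 2); first by rewrite divr_gt0.
move=> r s rt rs; apply: (dP (d / 2)) => //=.
- by rewrite sub0r normrN gtr0_norm ?divr_gt0// gtr_pMr// invf_lt1// ltr1n.
- by rewrite divr_gt0.
Qed.

End ContinuousIntegrals.

(** * Bochner integrals of continuous functions *)

Section Bochner.
Context (R : realType) (E : completeNormedModType R).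

Notation mu := (@lebesgue_measure R).

Section SimpleFunctions.
Context (D : set R) (mD : measurable D) (finD : (mu D < +oo)%E).
Context (s : R -> E) (simple_s : bochner_simple D s).

Local Notation vals := (finmap.enum_fset (fset_set (s @` D))).
Local Notation level v := (D `&` s @^-1` [set v]).

Lemma simple_level_sum (g : E -> R -> R) r : D r ->
  g (s r) r = \sum_(v <- vals) g v r * \1_(level v) r.
Proof.
have [fs _ _] := simple_s.
move=> Dr; rewrite (bigD1_seq (s r)) ?finmap.fset_uniq//=; last first.
  by apply: etrans (in_fset_set fs (s r)) _; apply: mem_set; exists r.
rewrite indicE mem_set// mulr1 big1 ?addr0// => v vs.
by rewrite indicE memNset ?mulr0// => -[_ /= sv]; rewrite sv eqxx in vs.
Qed.

Lemma simple_comp_measurable (g : E -> R -> R) :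
  (forall v, measurable_fun D (g v)) -> measurable_fun D (fun r => g (s r) r).
Proof.
have [_ ms _] := simple_s; move=> mg.
apply: (eq_measurable_fun (fun r => \sum_(v <- vals) g v r * \1_(level v) r)).
  by move=> r; rewrite inE => Dr; rewrite -simple_level_sum.
apply: measurable_sum => v; apply: measurable_funM.
  exact: mg.
exact: measurable_indic.
Qed.

(** Functionals turn Bochner integrals into Lebesgue integrals; all that is used
    of a Bochner integral is its value under functionals. *)
Lemma simple_integral_weak (y : E -> R) : scalar y ->
  mu.-integrable D (EFin \o (y \o s)) /\
  y (simple_integral D s) = \int[mu]_(r in D) y (s r).
Proof.
have [fs ms _] := simple_s; move=> ly.
have ilevel v : mu.-integrable D (fun r => (\1_(level v) r)%:E).
  apply/integrableP; split; first apply/measurable_EFinP.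
    by apply: measurable_indic; exact: ms.
  under eq_integral do rewrite gee0_abs ?lee_fin//.
  rewrite (integral_indic mu mD (ms v)); apply: le_lt_trans finD.
  by apply: le_measure; rewrite ?inE//; apply: measurableI => //; exact: ms.
have iZlevel v : mu.-integrable D (fun r => (y v * \1_(level v) r)%:E).
  exact: (@integrableZl _ _ _ mu D mD (y v) _ (ilevel v)).
have isum : mu.-integrable D (fun r => (\sum_(v <- vals) (y v * \1_(level v) r)%:E)%E).
  exact: integrable_sum.
have eqs r : D r -> (y (s r))%:E = (\sum_(v <- vals) (y v * \1_(level v) r)%:E)%E.
  by move=> Dr; rewrite sumEFin (simple_level_sum (fun v _ => y v) Dr).
split.
  apply: eq_integrable isum => // r; rewrite inE => Dr.
  by rewrite -eqs.
transitivity (fine (\int[mu]_(r in D) (\sum_(v <- vals) (y v * \1_(level v) r)%:E)))%E;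
  last by congr fine; apply: eq_integral => r; rewrite inE => Dr; rewrite -eqs.
rewrite integral_sum//.
have Il v : (\int[mu]_(r in D) (y v * \1_(level v) r)%:E)%E =
    (fine (mu (level v)) * y v)%:E.
  under eq_integral do rewrite EFinM.
  rewrite integralZl//.
  rewrite (integral_indic mu mD (ms v)) setIAC setIid muleC EFinM fineK//.
  rewrite ge0_fin_numE//; apply: le_lt_trans finD.
  by apply: le_measure; rewrite ?inE//; exact: ms.
rewrite (eq_bigr _ (fun v _ => Il v)) sumEFin /=.
rewrite /simple_integral fsbig_finite//=.
elim: (finmap.enum_fset _) => [|v l ih]; first by rewrite !big_nil scalar_fun0.
by rewrite !big_cons ly ih.
Qed.

End SimpleFunctions.

Section ContinuousIntegrand.
Context (t : R) (t0 : 0 < t) (F f : R -> E) (cF : continuous F).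
Hypothesis fF : forall r, 0 <= r <= t -> f r = F r.

Notation D := (`[0, t]%classic : set R).

Lemma itv_finite_measure : (mu D < +oo)%E.
Proof. by rewrite [ltLHS](lebesgue_measure_itv `[0, t])/= lte_fin t0 ltry. Qed.

Lemma simple_dist_measurable (s : R -> E) : bochner_simple D s ->
  measurable_fun D (fun r => `|f r - s r|).
Proof.
move=> ss; apply: (simple_comp_measurable ss (g := fun v r => `|f r - v|)) => // v.
apply: (eq_measurable_fun (fun r => `|F r - v|)).
  by move=> r; rewrite inE/= in_itv/= => /fF ->.
apply: measurable_funTS; apply: continuous_measurable_fun => r.
by apply: cvg_norm; apply: cvgB; [exact: cF|exact: cvg_cst].
Qed.

Definition step_approx (n : nat) (r : R) : E :=
  F (t / n.+1%:R * (Num.truncn (r * n.+1%:R / t))%:R).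

Lemma step_approx_index n r : 0 <= r ->
  t / n.+1%:R * (Num.truncn (r * n.+1%:R / t))%:R <= r <
  t / n.+1%:R * (Num.truncn (r * n.+1%:R / t))%:R + t / n.+1%:R.
Proof.
move=> r0; have x0 : 0 <= r * n.+1%:R / t by rewrite !mulr_ge0// invr_ge0 ltW.
have := truncn_itv x0; set k : R := (Num.truncn _)%:R.
have -> : (Num.truncn (r * n.+1%:R / t)).+1%:R = k + 1 by rewrite -natr1.
rewrite ler_pdivlMr// ltr_pdivrMr// => /andP[h1 h2].
rewrite -[X in _ < _ + X]mulr1 -mulrDr; apply/andP; split.
  by rewrite mulrAC ler_pdivrMr// [leLHS]mulrC.
by rewrite mulrAC ltr_pdivlMr// [ltRHS]mulrC.
Qed.

Lemma step_approx_simple n : bochner_simple D (step_approx n).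
Proof.
have idx r : 0 <= r -> 0 <= r * n.+1%:R / t by move=> r0; rewrite !mulr_ge0// invr_ge0 ltW.
have mlevel v : measurable (D `&` step_approx n @^-1` [set v]).
  rewrite (_ : _ `&` _ = \bigcup_(k in [set k : nat | F (t / n.+1%:R * k%:R) = v])
      (D `&` `[t / n.+1%:R * k%:R, t / n.+1%:R * k.+1%:R[)).
    by apply: bigcup_measurable => k _; apply: measurableI; exact: measurable_itv.
  apply/seteqP; split => r /=.
    move=> [Dr sr]; exists (Num.truncn (r * n.+1%:R / t)) => //; split => //.
    move: Dr; rewrite !in_itv/= => /andP[r0 _].
    rewrite -[(Num.truncn _).+1%:R]natr1 mulrDr mulr1.
    exact: step_approx_index.
  move=> [k /= Fk [Dr]]; rewrite in_itv/= => kr; split => //.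
  rewrite /step_approx (@truncn_def _ _ k)//.
  move: kr => /andP[h1 h2]; rewrite ler_pdivlMr// ltr_pdivrMr//; apply/andP; split.
    by move: h1; rewrite mulrAC ler_pdivrMr// [leLHS]mulrC.
  by move: h2; rewrite mulrAC ltr_pdivlMr// [ltRHS]mulrC.
split.
- apply: (@sub_finite_set _ _ ((fun k : nat => F (t / n.+1%:R * k%:R)) @` `I_n.+2)).
    move=> _ [r Dr <-]; exists (Num.truncn (r * n.+1%:R / t)) => //=.
    move: Dr; rewrite /= in_itv/= => /andP[r0 rt].
    rewrite ltnS -(ler_nat R); have /andP[h _] := truncn_itv (idx _ r0).
    by apply: (le_trans h); rewrite ler_pdivrMr// mulrC ler_wpM2l.
  exact: finite_image.
- exact: mlevel.
- move=> v _; apply: le_lt_trans itv_finite_measure.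
  by apply: le_measure; rewrite ?inE//; exact: mlevel.
Qed.

Lemma step_approx_unif (e : R) : 0 < e -> exists N : nat, forall n, (N <= n)%N ->
  forall r, 0 <= r <= t -> `|f r - step_approx n r| < e.
Proof.
move=> e0; have [d d0 dF] := uniform_continuity t cF e0.
exists (Num.bound (t / d)) => n Nn r rt; rewrite fF//; apply: dF => //.
have /andP[r0 _] := rt; have := step_approx_index n r0 => /=.
set a := _ * _; move=> /andP[h1 h2].
have h3 : t / n.+1%:R < d.
  rewrite ltr_pdivrMr// mulrC -ltr_pdivrMr//.
  apply: (lt_trans (archi_boundP _)); first by rewrite divr_ge0 ?(ltW t0) ?(ltW d0).
  by rewrite ltr_nat ltnS.
rewrite ger0_norm ?subr_ge0//; clearbody a.
by move: (t / n.+1%:R) h1 h2 h3 => b; lra.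
Qed.

(** A norming functional reduces the estimate to a scalar integral. *)
Lemma simple_integral_dist (s1 s2 : R -> E) c : bochner_simple D s1 ->
  bochner_simple D s2 -> (forall r, 0 <= r <= t -> `|s1 r - s2 r| <= c) ->
  `|simple_integral D s1 - simple_integral D s2| <= c * t.
Proof.
move=> ss1 ss2 sc.
have [y [dy yb <-]] := norming_functional (simple_integral D s1 - simple_integral D s2).
have [i1 e1] := simple_integral_weak (measurable_itv _) itv_finite_measure ss1 dy.1.
have [i2 e2] := simple_integral_weak (measurable_itv _) itv_finite_measure ss2 dy.1.
rewrite (scalar_funB dy.1) e1 e2 -RintegralB//.
rewrite -(itv_integral_cst c (ltW t0)) /itv_integral; apply: le_Rintegral => //.
- exact: (integrableB _ i1 i2).
- by apply: (@continuous_integrable R (fun=> c)) => x; exact: cvg_cst.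
- move=> r /=; rewrite in_itv/= => rt; rewrite -(scalar_funB dy.1).
  exact: le_trans (ler_norm _) (le_trans (yb _) (sc r rt)).
Qed.

Lemma continuous_bochner_integral : exists v, is_bochner_integral D f v.
Proof.
have [|v hv] := @cauchy_seq_cvg R E (fun n => simple_integral D (step_approx n)).
  move=> e e0; have t1 : 0 < 2 * t + 1 by rewrite addr_gt0// mulr_gt0.
  have e1 : 0 < e / (2 * t + 1) by rewrite divr_gt0.
  have [N hN] := step_approx_unif e1; exists N => m n Nm Nn.
  apply: (@le_lt_trans _ _ (2 * (e / (2 * t + 1)) * t)).
    apply: simple_integral_dist; try exact: step_approx_simple.
    move=> r rt; have := hN m Nm r rt; have := hN n Nn r rt.
    have := ler_distD (f r) (step_approx m r) (step_approx n r).
    by rewrite (distrC (step_approx m r) (f r)); move: (e / _) => c; lra.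
  by rewrite mulrAC mulrCA mulrA ltr_pdivrMr// ltr_pM2l// ltrDl.
exists v, step_approx; split => //.
- exact: step_approx_simple.
- apply/aeW => r Dr; apply/cvg_seqP => e e0; have [N hN] := step_approx_unif e0.
  exists N => n Nn; rewrite distrC; exact: hN.
(* The distance to the integrand is known to be bounded, hence integrable,
   only for large [n]. *)
- have [N0 hN0] := step_approx_unif ltr01.
  have fin n : (N0 <= n)%N ->
      mu.-integrable D (EFin \o (fun r => `|f r - step_approx n r|)).
    move=> Nn; apply: measurable_bounded_integrable => //.
    + exact: itv_finite_measure.
    + by apply: simple_dist_measurable; exact: step_approx_simple.
    + exists 1; split; first exact: num_real.
      move=> M M1 r /=; rewrite in_itv/= => rt; rewrite normr_id ltW//.
      exact: lt_trans (hN0 n Nn r rt) M1.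
  apply/fine_cvgP; split; first by exists N0 => // n /= Nn; exact: integrable_fin_num (fin n Nn).
  apply/cvg_seqP => e e0; have t1 : 0 < t + 1 by rewrite addr_gt0.
  have e1 : 0 < e / (t + 1) by rewrite divr_gt0.
  have [N hN] := step_approx_unif e1; exists (maxn N0 N) => n.
  rewrite geq_max => /andP[N0n Nn]; rewrite subr0.
  rewrite ger0_norm; last by apply: (@Rintegral_ge0 _ _ _ mu D (fun r => `|f r - step_approx n r|)).
  apply: (@le_lt_trans _ _ (e / (t + 1) * t)); last first.
    by rewrite mulrAC ltr_pdivrMr// ltr_pM2l// ltrDl.
  rewrite -(itv_integral_cst _ (ltW t0)) /itv_integral; apply: le_Rintegral => //.
  + exact: fin.
  + by apply: (@continuous_integrable R (fun=> _)) => x; exact: cvg_cst.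
  + by move=> r /=; rewrite in_itv/= => rt; apply/ltW/hN.
Qed.

Lemma bochner_integral_weak v (y : E -> R) : is_bochner_integral D f v -> dual y ->
  y v = itv_integral (y \o F) t.
Proof.
move=> [s [ss _ sI sv]] dy; have [C C0 yC] := dual_bounded dy.
have cyF : continuous (y \o F).
  by move=> r; apply: continuous_comp; [exact: cF|exact: dy.2].
have iyF := continuous_integrable 0 t cyF.
have yv : y (simple_integral D (s n)) @[n --> \oo] --> y v.
  by apply: (cvg_comp _ _ sv); exact: dy.2.
apply: (@cvg_unique _ (@Rhausdorff R)) yv _.
move/fine_cvgP: sI => [[N1 _ fin] sI]; apply/cvg_seqP => e e0.
have e1 : 0 < e / C by rewrite divr_gt0.
have [N2 hN2] := (cvg_seqP _ _).1 sI _ e1.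
exists (maxn N1 N2) => n; rewrite geq_max => /andP[n1 n2].
have [iys eys] := simple_integral_weak (measurable_itv _) itv_finite_measure (ss n) dy.1.
have mfs := simple_dist_measurable (ss n).
have ifs : mu.-integrable D (EFin \o (fun r => `|f r - s n r|)).
  apply/integrableP; split; first exact/measurable_EFinP.
  under eq_integral do rewrite /= normr_id.
  by rewrite -ge0_fin_numE ?integral_ge0//; exact: fin.
have idf : mu.-integrable D (EFin \o (fun r => y (s n r) - (y \o F) r)).
  exact: (integrableB _ iys iyF).
rewrite eys /itv_integral -RintegralB//.
apply: (le_lt_trans (le_normr_Rintegral _ idf)) => //.
have := hN2 n n2; rewrite subr0 ltr_pdivlMr// mulrC => h.
apply: le_lt_trans (le_lt_trans (ler_wpM2l (ltW C0) (ler_norm _)) h).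
rewrite -[fine _]/(\int[mu]_(r in D) `|f r - s n r|) -RintegralZl//.
apply: le_Rintegral => //.
- exact: (integrable_norm idf).
- exact: (@integrableZl _ _ _ mu D _ C _ ifs).
- move=> r /=; rewrite in_itv/= => rt; rewrite -(scalar_funB dy.1).
  by rewrite (le_trans (yC _))// ler_wpM2l ?(ltW C0)// distrC fF.
Qed.

End ContinuousIntegrand.
End Bochner.

(** * Strongly continuous semigroups *)

Section Semigroups.
Context (R : realType).

Lemma cvg_right0P (V : normedModType R) (f : R -> V) (l : V) :
  f s @[s --> 0^'+] --> l <->
  forall e : R, 0 < e -> exists2 d : R, 0 < d &
    forall s, 0 < s -> s < d -> `|f s - l| < e.
Proof.
split=> [/cvgrPdist_lt h e e0|h].
  have [d /= d0 dP] := h e e0; exists d => // s s0 sd.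
  by rewrite distrC; apply: dP => //=; rewrite sub0r normrN gtr0_norm.
apply/cvgrPdist_lt => e e0; have [d d0 dP] := h e e0.
exists d => //= s /=; rewrite sub0r normrN => sd s0; rewrite distrC; apply: dP => //.
exact: le_lt_trans (ler_norm _) sd.
Qed.

Section LocalBound.
Context (X : completeNormedModType R) (T : R -> {linear X -> X}).
Hypothesis sgT : C0_semigroup T.

(** Otherwise there are times tending to [0] at which the operators are unbounded
    in norm, although each orbit converges there: this contradicts the
    Banach-Steinhaus theorem. *)
Lemma semigroup_bound0 : exists d M : R, [/\ 0 < d, 0 <= M &
  forall s, 0 <= s <= d -> forall x, `|T s x| <= M * `|x|].
Proof.
have [cT T0 TD Tc] := sgT.
apply: contrapT => nb.
have sex (n : nat) : exists p : R * X,
    0 <= p.1 <= n.+1%:R^-1 /\ n%:R * `|p.2| < `|T p.1 p.2|.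
  apply: contrapT => np; apply: nb; exists n.+1%:R^-1, n%:R; split=> //.
  by move=> s sn x; rewrite leNgt; apply/negP => h; apply: np; exists (s, x).
have [p pP] := choice sex.
pose F : set (X -> X) := [set f | exists n, f = (T (p n).1 : X -> X)].
have [||M MF] := @Banach_Steinhauss R X X F _ _ 1.
- move=> _ [n ->]; split; last exact: linearP.
  have p0 : 0 <= (p n).1 by have [/andP[]] := pP n.
  have [k k0 kP] := linear_lipschitz (cT _ p0).
  move=> r; exists (k * r) => x xr; rewrite (le_trans (kP x))// ler_wpM2l// ltW//.
- move=> x; have [d d0 dP] := (cvg_right0P _ _).1 (Tc x) 1 ltr01.
  have [N hN] := (cvg_seqP _ _).1 (@cvg_harmonic R) d d0.
  exists (`|x| + 1 + \sum_(n < N) `|T (p n).1 x|) => _ [n ->].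
  have [nN|Nn] := ltnP n N.
    rewrite (bigD1 (Ordinal nN))//= addrCA lerDl addr_ge0//.
    exact: sumr_ge0.
  have h : `|T (p n).1 x| <= `|x| + 1.
    have [/andP[p0 p1] _] := pP n.
    have [->|pn0] := eqVneq (p n).1 0; first by rewrite T0 lerDl.
    have := dP (p n).1; rewrite lt_def pn0 p0 => /(_ isT).
    have -> : (p n).1 < d.
      by apply: le_lt_trans p1 _; have := hN n Nn; rewrite subr0; apply: le_lt_trans (ler_norm _).
    by move=> /(_ isT); have := lerB_dist (T (p n).1 x) x; lra.
  by rewrite (le_trans h)// lerDl sumr_ge0.
pose n := Num.bound M.
have Fn : F (T (p n).1) by exists n.
have [_ pn] := pP n.
have x0 : 0 < `|(p n).2|.
  rewrite normr_gt0; apply/eqP => x0; move: pn.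
  by rewrite x0 linear0 !normr0 mulr0 ltxx.
have := MF _ Fn (`|(p n).2|^-1 *: (p n).2).
rewrite normrZ normfV normr_id mulVf ?gt_eqF// => /(_ (lexx _)).
rewrite linearZ normrZ normfV normr_id ler_pdivrMl// => h.
have := lt_le_trans pn h; rewrite mulrC ltr_pM2l// => nM.
have M0 : 0 <= M by rewrite ltW// (le_lt_trans _ nM).
by have := archi_boundP M0; rewrite ltNge (ltW nM).
Qed.

Lemma semigroup_locally_bounded t : exists2 M : R, 0 <= M &
  forall s, 0 <= s <= t -> forall x, `|T s x| <= M * `|x|.
Proof.
have [d [M [d0 M0 dM]]] := semigroup_bound0; have [cT T0 TD Tc] := sgT.
have h (n : nat) s : 0 <= s <= n%:R * d -> forall x, `|T s x| <= Num.max 1 M ^+ n * `|x|.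
  elim: n s => [|n ih] s /andP[s0 sn] x.
    by rewrite expr0 mul1r (_ : s = 0) ?T0//; apply/eqP; rewrite eq_le s0 -(mul0r d) sn.
  have m1 : 1 <= Num.max 1 M by rewrite le_max lexx.
  have [sd|ds] := leP s d.
    have sd' : 0 <= s <= d by rewrite s0 sd.
    rewrite (le_trans (dM s sd' x))// ler_wpM2r// exprS.
    rewrite -[leLHS]mulr1 ler_pM//; first by rewrite le_max lexx orbT.
    exact: exprn_ege1.
  rewrite -(subrK d s) addrC TD ?subr_ge0//; [|exact: ltW|exact: ltW].
  have d1 : 0 <= d <= d by rewrite lexx ltW.
  rewrite (le_trans (dM d d1 _))// exprS -mulrA ler_pM//.
    by rewrite le_max lexx orbT.
  apply: ih; rewrite subr_ge0 (ltW ds)/= lerBlDr.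
  by rewrite (le_trans sn)// -natr1 mulrDl mul1r.
exists (Num.max 1 M ^+ Num.bound (t / d)).
  by rewrite exprn_ge0// le_max ler01.
move=> s /andP[s0 st] x; apply: h; rewrite s0/= (le_trans st)//.
have [t0|t0] := leP 0 t; last by rewrite (le_trans (ltW t0))// mulr_ge0// ltW.
by rewrite -ler_pdivrMr// ltW// archi_boundP// divr_ge0// ltW.
Qed.

(** The even extension in time makes orbits continuous functions on the whole
    line, to which the integral of continuous functions applies. *)
Lemma semigroup_continuous x : continuous (fun s : R => T `|s| x).
Proof.
have [cT T0 TD Tc] := sgT.
move=> s; apply/cvgrPdist_lt => e e0.
have [M M0 MP] := semigroup_locally_bounded (`|s| + 1).
have M1 : 0 < M + 1 by rewrite ltr_wpDl.
have [d d0 dP] := (cvg_right0P _ _).1 (Tc x) (e / (M + 1)) (divr_gt0 e0 M1).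
have key a b : 0 <= a -> a < b -> b <= `|s| + 1 -> b - a < d -> `|T b x - T a x| < e.
  move=> a0 ab b1 bad; have -> : T b x = T a (T (b - a) x).
    by rewrite -TD ?subr_ge0 ?(ltW ab)// addrC subrK.
  rewrite -(linearB (T a)).
  have a1 : 0 <= a <= `|s| + 1 by rewrite a0 (le_trans (ltW ab)).
  rewrite (le_lt_trans (MP a a1 _))//.
  have ba0 : 0 < b - a by rewrite subr_gt0.
  have := dP (b - a) ba0 bad; rewrite ltr_pdivlMr// mulrC; apply: le_lt_trans.
  by rewrite ler_wpM2r// lerDl.
apply/nbhs_ballP; exists (Num.min 1 d) => /=; first by rewrite lt_min ltr01 d0.
move=> r /=; rewrite /ball /= lt_min => /andP[sr1 srd].
have d1 := ler_dist_dist s r.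
have [rs|rs|->] := ltgtP `|r| `|s|; last by rewrite subrr normr0.
  apply: key => //; first by rewrite lerDl.
  exact: le_lt_trans (le_trans (ler_norm _) d1) srd.
have d2 := ler_dist_dist r s; rewrite (distrC r s) in d2.
rewrite distrC; apply: key => //.
  by rewrite -lerBlDl (le_trans (ler_norm _))// (le_trans d2)// ltW.
exact: le_lt_trans (le_trans (ler_norm _) d2) srd.
Qed.

End LocalBound.

End Semigroups.

(** * The adjoint semigroup *)

Section AdjointSemigroup.
Context (R : realType) (H : completeNormedModType R).
Context (ip : {dot H for (idfun : R -> R)}) (hilbertH : induces_norm ip).
Context (T : R -> {linear H -> H}) (sgT : C0_semigroup T).

Lemma semigroup_bounded (s : R) : exists2 M : R, 0 <= M &
  forall x : H, `|T (`|s|) x| <= M * `|x|.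
Proof.
have [M M0 MP] := semigroup_locally_bounded sgT `|s|.
by exists M => // x; apply: MP; rewrite normr_ge0 lexx.
Qed.

Lemma adjoint_semigroup_linear (s : R) : linear (adjoint ip (T `|s|)).
Proof. by have [M M0 MP] := semigroup_bounded s; exact: adjoint_linear MP. Qed.

(** Reflecting negative times keeps every operator of the family bounded. *)
Definition adjoint_semigroup (s : R) : {linear H -> H} :=
  HB.pack (adjoint ip (T `|s|))
    (GRing.isLinear.Build _ _ _ _ _ (adjoint_semigroup_linear s)).

Local Notation Ta := adjoint_semigroup.

Lemma adjoint_semigroupP s k h : 0 <= s -> ip (T s k) h = ip k (Ta s h).
Proof.
move=> s0; have [M M0 MP] := semigroup_bounded s.
by rewrite -(adjointP hilbertH MP) ger0_norm.
Qed.

Lemma adjoint_semigroup_bound t M : 0 <= t -> (forall x, `|T t x| <= M * `|x|) ->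
  forall x, `|Ta t x| <= M * `|x|.
Proof.
by move=> t0 MP; apply: (adjoint_bound hilbertH); rewrite ger0_norm.
Qed.

Lemma adjoint_semigroup_bound_inv t M : 0 <= t ->
  (forall x, `|Ta t x| <= M * `|x|) -> forall x, `|T t x| <= M * `|x|.
Proof.
move=> t0 MP; have [M' M'0 M'P] := semigroup_bounded t.
by rewrite -[t in T t](ger0_norm t0); exact: (adjoint_bound_inv hilbertH M'P).
Qed.

Lemma adjoint_semigroup0 h : Ta 0 h = h.
Proof.
have [_ T0 _ _] := sgT; apply: (ip_ext hilbertH) => k.
by rewrite -adjoint_semigroupP// T0.
Qed.

Lemma adjoint_semigroupD s t h : 0 <= s -> 0 <= t -> Ta (s + t) h = Ta s (Ta t h).
Proof.
move=> s0 t0; have [_ _ TD _] := sgT; apply: (ip_ext hilbertH) => k.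
rewrite -adjoint_semigroupP ?addr_ge0// addrC TD//.
by rewrite adjoint_semigroupP// adjoint_semigroupP.
Qed.

Definition continuous_orbit (h : H) : Prop :=
  forall e : R, 0 < e -> exists2 d : R, 0 < d &
    forall s, 0 < s -> s < d -> `|Ta s h - h| < e.

Lemma continuous_orbit_subspace : linear_subspace continuous_orbit.
Proof.
split=> [e e0|a x y cx cy e e0].
  by exists 1 => // s _ _; rewrite linear0 subrr normr0.
have a1 : 0 < `|a| + 1 by rewrite ltr_wpDl.
have e1 : 0 < e / 2 / (`|a| + 1) by rewrite !divr_gt0.
have [d1 d10 h1] := cx _ e1; have [d2 d20 h2] := cy _ (divr_gt0 e0 (ltr0n _ 2)).
exists (Num.min d1 d2); first by rewrite lt_min d10.
move=> s s0; rewrite lt_min => /andP[sd1 sd2].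
rewrite linearP opprD addrACA -scalerBr [ltRHS]splitr.
rewrite (le_lt_trans (ler_normD _ _))// ler_ltD ?h2// normrZ.
have := ltW (h1 s s0 sd1); rewrite ler_pdivlMr// mulrC; apply: le_trans.
by rewrite ler_wpM2r// lerDl.
Qed.

(** Cesaro means of orbits of the adjoint, defined weakly, have continuous
    orbits: translating the interval of integration changes the integral only
    near its two ends. *)
Lemma mean_orbit t g : 0 < t -> t <= 1 -> exists2 gt : H, continuous_orbit gt &
  forall k, ip k gt = itv_integral (fun s : R => ip (T `|s| k) g) t.
Proof.
move=> t0 t1; have [M M0 MP] := semigroup_locally_bounded sgT 2.
have [_ T0 TD _] := sgT.
pose phi k (s : R) := ip (T `|s| k) g.
have cphi k : continuous (phi k).
  move=> s; apply: (@continuous_comp _ _ _ (fun s : R => T `|s| k) (fun u => ip u g)).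
    exact: semigroup_continuous.
  apply: (scalar_bounded_continuous (C := `|g|)); first exact: ip_scalarl.
  by move=> u; rewrite mulrC (ip_cauchy_schwarz hilbertH).
have phib k s : 0 <= s <= 2 -> `|phi k s| <= M * `|g| * `|k|.
  move=> s2; rewrite (le_trans (ip_cauchy_schwarz hilbertH _ _))//.
  rewrite mulrAC ler_wpM2r// ger0_norm; first exact: MP.
  by case/andP: s2.
have lphi : scalar (fun k => itv_integral (phi k) t).
  move=> a x y /=; rewrite -itv_integral_lin//; apply: itv_integral_eq => s _.
  by rewrite /phi linearP ipl.
have bphi k : `|itv_integral (phi k) t| <= M * `|g| * t * `|k|.
  rewrite mulrAC; apply: itv_integral_bound => //; first exact: ltW.
  by move=> s /andP[s0 st]; apply: phib; lra.
have gtP := rieszP hilbertH lphi bphi.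
exists (riesz ip (fun k => itv_integral (phi k) t)); last by move=> k; rewrite -gtP.
set gt := riesz _ _; move=> e e0.
pose C := 2 * (M * `|g|) + 1.
have C0 : 0 < C by rewrite ltr_wpDl// mulr_ge0// mulr_ge0.
exists (Num.min 1 (e / C)); first by rewrite lt_min ltr01 divr_gt0.
move=> r r0; rewrite lt_min => /andP[r1 re].
have key k : ip k (Ta r gt - gt) <= 2 * (M * `|g|) * r * `|k|.
  rewrite (ipBr) -adjoint_semigroupP ?(ltW r0)// -!gtP.
  have -> : itv_integral (phi (T r k)) t = itv_integral (fun s => phi k (s + r)) t.
    apply: itv_integral_eq => s /andP[s0 _]; rewrite /phi -TD// ?(ltW r0)//.
    by rewrite !ger0_norm// addr_ge0// ltW.
  have e1 := itv_integralD (cphi k) (ltW r0) (ltW t0).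
  have e2 := itv_integralD (cphi k) (ltW t0) (ltW r0).
  rewrite addrC e2 in e1.
  have b1 : `|itv_integral (phi k) r| <= M * `|g| * `|k| * r.
    apply: itv_integral_bound => //; first exact: ltW.
    by move=> s /andP[s0 sr]; apply: phib; lra.
  have b2 : `|itv_integral (fun s => phi k (s + t)) r| <= M * `|g| * `|k| * r.
    apply: itv_integral_bound => //; last 2 first.
    - exact: ltW.
    - by move=> s /andP[s0 sr]; apply: phib; lra.
    move=> s; apply: (@continuous_comp _ _ _ (fun s : R => s + t) (phi k)).
      by apply: cvgD; [exact: cvg_id|exact: cvg_cst].
    exact: cphi.
  move: b1 b2; rewrite !ler_norml => /andP[b1 _] /andP[_ b2].
  by rewrite -!mulrA; rewrite -!mulrA in b1 b2; rewrite (mulrC r); lra.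
have [->|n0] := eqVneq (Ta r gt - gt) 0; first by rewrite normr0.
have np : 0 < `|Ta r gt - gt| by rewrite normr_gt0.
have := key (Ta r gt - gt); rewrite -hilbertH expr2 ler_pM2r// => h.
apply: (le_lt_trans h); rewrite mulrC.
move: re; rewrite ltr_pdivlMr// /C mulrDr mulr1; apply: lt_trans.
by rewrite ltrDl.
Qed.

(** The vectors with continuous orbits form a closed subspace. A vector [g]
    orthogonal to it is orthogonal to its own means, whereas
    [ip (T s g) g] is close to [|g|^2] for small [s]. *)
Lemma adjoint_semigroup_C0 : C0_semigroup Ta.
Proof.
have [cT T0 TD Tc] := sgT.
split.
- move=> t t0; have [M M0 MP] := semigroup_bounded t.
  apply: bounded_linear_continuous; apply/linear_boundedP.
  exists M; split; first exact: num_real.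
  move=> r /ltW Mr x; rewrite (le_trans _ (ler_wpM2r _ Mr))//.
  by apply: adjoint_semigroup_bound => //; rewrite -{1}(ger0_norm t0).
- exact: adjoint_semigroup0.
- by move=> s t s0 t0 x; exact: adjoint_semigroupD.
move=> h; apply/cvg_right0P => e e0.
have [M M0 MP] := semigroup_locally_bounded sgT 1.
have C0 : 0 < M + 2 by rewrite ltr_wpDl.
have [g orth|k kc kh] := @subspace_approx _ _ _ hilbertH _ continuous_orbit_subspace _ h
    (e / (M + 2)) (divr_gt0 e0 C0).
  apply: contrapT => /eqP g0.
  have gp : 0 < `|g| by rewrite normr_gt0.
  have [d d0 dP] := (cvg_right0P _ _).1 (Tc g) (`|g| / 2) (divr_gt0 gp (ltr0n _ 2)).
  pose t := Num.min 1 (d / 2).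
  have t0 : 0 < t by rewrite lt_min ltr01 divr_gt0.
  have t1 : t <= 1 by rewrite ge_min lexx.
  have td : t < d.
    by rewrite gt_min; apply/orP; right; rewrite gtr_pMr// invf_lt1// ltr1n.
  have [gt gtc gtP] := mean_orbit g t0 t1.
  have := orth _ gtc; rewrite ipC gtP.
  have cg : continuous (fun s : R => ip (T `|s| g) g).
    move=> s; apply: (@continuous_comp _ _ _ (fun s : R => T `|s| g) (fun u => ip u g)).
      exact: semigroup_continuous.
    apply: (scalar_bounded_continuous (C := `|g|)); first exact: ip_scalarl.
    by move=> u; rewrite mulrC (ip_cauchy_schwarz hilbertH).
  have : itv_integral (fun=> `|g| ^+ 2 / 2) t <= itv_integral (fun s : R => ip (T `|s| g) g) t.
    apply: itv_integral_le => //; first by move=> x; exact: cvg_cst.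
    move=> s /andP[s0 st]; rewrite ger0_norm//.
    have -> : ip (T s g) g = `|g| ^+ 2 + ip (T s g - g) g by rewrite ipBl -hilbertH; ring.
    have h1 : `|T s g - g| <= `|g| / 2.
      have [->|sn0] := eqVneq s 0; first by rewrite T0 subrr normr0 divr_ge0.
      by apply/ltW/dP; [rewrite lt_def sn0|exact: le_lt_trans td].
    have h2 := ip_cauchy_schwarz hilbertH (T s g - g) g.
    have h3 := ler_wpM2r (normr_ge0 g) h1.
    move: h2; rewrite ler_norml => /andP[h2 _].
    rewrite expr2; have : `|g| / 2 * `|g| = `|g| * `|g| / 2 by ring.
    by move=> h4; rewrite h4 in h3; lra.
  rewrite itv_integral_cst ?(ltW t0)// => h1 h2; rewrite h2 in h1.
  have : 0 < `|g| ^+ 2 / 2 * t by rewrite mulr_gt0// divr_gt0// exprn_gt0.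
  by rewrite ltNge h1.
have [d d0 dP] := kc _ (divr_gt0 e0 C0).
exists (Num.min 1 d); first by rewrite lt_min ltr01.
move=> s s0; rewrite lt_min => /andP[s1 sd].
have -> : Ta s h - h = Ta s (h - k) + (Ta s k - k) + (k - h).
  by rewrite (linearB (Ta s)) !subrKA.
rewrite (le_lt_trans (ler_normD _ _))// (le_lt_trans (lerD (ler_normD _ _) (lexx _)))//.
have h1 : `|Ta s (h - k)| <= M * `|h - k|.
  by apply: adjoint_semigroup_bound; [exact: ltW|apply: MP; rewrite !ltW].
rewrite distrC in kh.
have h2 := dP s s0 sd; rewrite (distrC k h).
have h3 := ler_wpM2l M0 (ltW kh).
have -> : e = M * (e / (M + 2)) + (e / (M + 2)) + (e / (M + 2)) by field; rewrite gt_eqF.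
by apply: ltrD => //; apply: ler_ltD => //; exact: le_trans h3.
Qed.

End AdjointSemigroup.

(** * Square integrable orbits and exponential stability *)

Section Datko.
Context (R : realType) (X : completeNormedModType R) (T : R -> {linear X -> X}).
Hypothesis sgT : C0_semigroup T.

Definition energy (x : X) (t : R) : R :=
  itv_integral (fun s : R => `|T `|s| x| ^+ 2) t.

Lemma energy_continuous x : continuous (fun s : R => `|T `|s| x| ^+ 2).
Proof.
move=> s; rewrite /=.
have h : (fun s : R => `|T `|s| x|) r @[r --> s] --> `|T `|s| x|.
  by apply: cvg_norm; exact: semigroup_continuous.
exact: (cvgM h h).
Qed.

Lemma energy_ge0 x t : 0 <= energy x t.
Proof. by apply: itv_integral_ge0 => s _; exact: sqr_ge0. Qed.

Lemma energyD x r t : 0 <= r -> 0 <= t ->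
  energy x (r + t) = energy x r + energy (T r x) t.
Proof.
move=> r0 t0; rewrite /energy itv_integralD//; last exact: energy_continuous.
congr (_ + _); apply: itv_integral_eq => s /andP[s0 _].
have [_ _ TD _] := sgT; rewrite !ger0_norm ?addr_ge0//.
by rewrite TD.
Qed.

Lemma energy_le x r t : 0 <= r -> r <= t -> energy x r <= energy x t.
Proof.
move=> r0 rt; rewrite -(subrK r t) addrC energyD// ?subr_ge0// lerDl.
exact: energy_ge0.
Qed.

Lemma energy_shift x r t c : 0 <= r -> (forall k, `|T r k| <= c * `|k|) ->
  energy (T r x) t <= c ^+ 2 * energy x t.
Proof.
move=> r0 rc; rewrite /energy; set f := fun s => _.
have cf : continuous f by exact: energy_continuous.
rewrite -itv_integralZ; last exact: energy_continuous.
apply: itv_integral_le => //.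
  by move=> s; apply: cvgMr; exact: energy_continuous.
move=> s /andP[s0 _]; rewrite /f ger0_norm// -exprMn.
have [_ _ TD _] := sgT.
rewrite ler_pXn2r ?nnegrE//; last exact: le_trans (rc _).
by rewrite -TD// addrC TD.
Qed.

Lemma energy_bounded t : 0 <= t -> exists2 K : R, 0 <= K &
  forall x, energy x t <= K * `|x| ^+ 2.
Proof.
move=> t0; have [M M0 MP] := semigroup_locally_bounded sgT t.
exists (M ^+ 2 * t); first by rewrite mulr_ge0// exprn_ge0.
move=> x; rewrite mulrAC -itv_integral_cst//.
apply: itv_integral_le; first exact: energy_continuous.
  by move=> s; exact: cvg_cst.
move=> s st; rewrite -exprMn ler_pXn2r ?nnegrE//; last by rewrite mulr_ge0.
by rewrite ger0_norm; [exact: MP|case/andP: st].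
Qed.

(** Up to time [t] the norm is halved as many times as [t0] fits into [t], and the
    remaining time less than [t0] costs a bounded factor. *)
Lemma exponential_decay t0 : 0 < t0 -> (forall x, `|T t0 x| <= 2^-1 * `|x|) ->
  exists M w : R, [/\ 0 <= M, 0 < w &
    forall t, 0 <= t -> forall x, `|T t x| <= M * expR (- (w * t)) * `|x|].
Proof.
move=> t00 half; have [M M0 MP] := semigroup_locally_bounded sgT t0.
have [_ T0 TD _] := sgT.
have ln20 : 0 < ln (2 : R) by rewrite ln_gt0// ltr1n.
exists (M * 2), (ln 2 / t0); split; first by rewrite mulr_ge0.
  by rewrite divr_gt0.
have Tn (n : nat) r : 0 <= r -> forall x, `|T (r + n%:R * t0) x| <= `|T r x| * 2 ^- n.
  move=> r0; elim: n => [|n ih] x; first by rewrite mul0r addr0 expr0 invr1 mulr1.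
  have -> : r + n.+1%:R * t0 = t0 + (r + n%:R * t0).
    by rewrite -natr1; ring.
  rewrite TD ?addr_ge0 ?mulr_ge0 ?(ltW t00)// (le_trans (half _))//.
  by rewrite exprS invfM mulrCA ler_wpM2l// ?invr_ge0// ih.
move=> t tge x.
pose n := Num.truncn (t / t0).
have /truncn_itv /andP[] : 0 <= t / t0 by rewrite divr_ge0// ltW.
rewrite -/n ler_pdivlMr// ltr_pdivrMr// => n1 n2.
have r0 : 0 <= t - n%:R * t0 by rewrite subr_ge0.
have rt : 0 <= t - n%:R * t0 <= t0.
  by move: n2; rewrite r0/= lerBlDl -natr1 mulrDl mul1r => /ltW.
have -> : T t x = T (t - n%:R * t0 + n%:R * t0) x by rewrite subrK.
rewrite (le_trans (Tn _ _ r0 x))//.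
suff h : 2 ^- n <= 2 * expR (- (ln 2 / t0 * t)).
  have -> : M * 2 * expR (- (ln 2 / t0 * t)) * `|x| =
    M * `|x| * (2 * expR (- (ln 2 / t0 * t))) by ring.
  by rewrite ler_pM// ?invr_ge0 ?exprn_ge0//; exact: MP.
have e2 : expR (ln 2) = 2 :> R by rewrite lnK// posrE.
have -> : 2 ^- n = 2 * expR (- (ln 2 * n.+1%:R)) :> R.
  by rewrite expRN expRM_natr e2 exprS invfM mulrA divff ?mul1r.
rewrite ler_wpM2l// ler_expR lerN2 -mulrA ler_wpM2l// ?ltW//.
by rewrite mulrC ltr_pdivrMr.
Qed.

(** Datko's theorem. As [T t x] is reached from [T s x] for each [s <= t],
    integrating over [s] bounds first [T t x], then [t |T t x|^2]. *)
Lemma datko K : 0 <= K ->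
  (forall t x, 0 <= t -> energy x t <= K * `|x| ^+ 2) ->
  exists M w : R, [/\ 0 <= M, 0 < w &
    forall t, 0 <= t -> forall x, `|T t x| <= M * expR (- (w * t)) * `|x|].
Proof.
move=> K0 TK; have [M M0 MP] := semigroup_locally_bounded sgT 1.
have [_ T0 TD _] := sgT.
have bound1 t x : 0 <= t -> `|T t x| ^+ 2 <= (M ^+ 2 * (K + 1)) * `|x| ^+ 2.
  move=> t0; have [t1|t1] := leP t 1.
    have tt : 0 <= t <= 1 by rewrite t0.
    have : `|T t x| ^+ 2 <= M ^+ 2 * `|x| ^+ 2.
      by rewrite -exprMn ler_pXn2r ?nnegrE ?MP// mulr_ge0.
    by move/le_trans; apply; rewrite -mulrA ler_wpM2l ?exprn_ge0// mulrDl mul1r lerDr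
      mulr_ge0// exprn_ge0.
  have r0 : 0 <= t - 1 by rewrite subr_ge0 ltW.
  have h1 : energy (T (t - 1) x) 1 <= K * `|x| ^+ 2.
    apply: le_trans (TK t x t0).
    by rewrite -[t in leRHS](subrK 1) energyD// lerDr energy_ge0.
  have h2 : `|T t x| ^+ 2 <= M ^+ 2 * energy (T (t - 1) x) 1.
    rewrite -[leLHS]mulr1 -(itv_integral_cst (`|T t x| ^+ 2) ler01) /energy.
    rewrite -itv_integralZ; last exact: energy_continuous.
    apply: itv_integral_le.
    - by move=> s; exact: cvg_cst.
    - by move=> s; apply: cvgMr; exact: energy_continuous.
    - move=> s /andP[s0 s1]; rewrite -exprMn ger0_norm// -TD//.
      have -> : T t x = T (1 - s) (T (s + (t - 1)) x).
        rewrite -TD ?subr_ge0//; last by rewrite addr_ge0.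
        by rewrite (_ : 1 - s + (s + (t - 1)) = t)//; ring.
      rewrite ler_pXn2r ?nnegrE ?mulr_ge0//; apply: MP.
      by rewrite subr_ge0 s1 gerBl.
  apply: (le_trans h2); rewrite -mulrA ler_wpM2l ?exprn_ge0//.
  by rewrite (le_trans h1)// mulrDl lerDl mul1r exprn_ge0.
set C := M ^+ 2 * (K + 1) in bound1.
have C0 : 0 <= C by rewrite mulr_ge0 ?exprn_ge0// addr_ge0.
have bound2 t x : 0 <= t -> t * `|T t x| ^+ 2 <= C * K * `|x| ^+ 2.
  move=> t0; rewrite mulrC -(itv_integral_cst (`|T t x| ^+ 2) t0).
  apply: (@le_trans _ _ (C * energy x t)); last by rewrite -mulrA ler_wpM2l// TK.
  rewrite /energy -itv_integralZ; last exact: energy_continuous.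
  apply: itv_integral_le.
  - by move=> s; exact: cvg_cst.
  - by move=> s; apply: cvgMr; exact: energy_continuous.
  - move=> s /andP[s0 st]; rewrite ger0_norm//.
    have -> : T t x = T (t - s) (T s x) by rewrite -TD ?subr_ge0// subrK.
    by apply: bound1; rewrite subr_ge0.
have t0 : 0 < 4 * (C * K) + 1 by rewrite ltr_wpDl// mulr_ge0// mulr_ge0.
apply: (exponential_decay t0) => x.
rewrite -(ler_pXn2r (n := 2))// ?nnegrE ?mulr_ge0//.
rewrite exprMn -(ler_pM2l t0) (le_trans (bound2 _ x (ltW t0)))//.
rewrite [leRHS]mulrA ler_wpM2r ?exprn_ge0//.
have -> : (4 * (C * K) + 1) * 2^-1 ^+ 2 = C * K + 4^-1 by field.
by rewrite lerDl invr_ge0.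
Qed.

End Datko.

Lemma exp_decay_small (R : realType) (M w : R) : 0 <= M -> 0 < w ->
  exists2 t, 0 < t & forall s, t <= s -> M * expR (- (w * s)) <= 2^-1.
Proof.
move=> M0 w0; have N0 : 0 < 2 * M + 1 by rewrite ltr_wpDl// mulr_ge0.
(* At this time [expR (w * s) >= 1 + w * s >= 2 * M]. *)
exists ((2 * M + 1) / w); first by rewrite divr_gt0.
move=> s; rewrite ler_pdivrMr// => h.
rewrite expRN -[leLHS]/(M / _) ler_pdivrMr ?expR_gt0//.
have := expR_ge1Dx (w * s); rewrite (mulrC w s).
move: (expR _) => E h2; lra.
Qed.

(** * The covariance operators and their spaces *)

Section StabilityOfCovariance.
Context (R : realType) (E : completeNormedModType R).
Context (S : R -> {linear E -> E}) (sgS : C0_semigroup S).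
Context (H : completeNormedModType R) (ip : {dot H for (idfun : R -> R)}).
Context (hilbertH : induces_norm ip).
Context (i : {linear H -> E}) (ci : continuous i) (inj_i : injective i).
Context (SH : R -> {linear H -> H}) (sgSH : C0_semigroup SH).
Hypothesis SHS : forall t, 0 <= t -> forall h, i (SH t h) = S t (i h).

Local Notation dualE := (@dual R E : set (E -> R^o)).
Local Notation a := (adjoint_semigroup hilbertH sgSH).
Local Notation sga := (adjoint_semigroup_C0 hilbertH sgSH).

(** The adjoint [i^*]. *)
Definition iadj (x : E -> R) : H := riesz ip (x \o i).
Local Notation j := iadj.

Lemma i_bounded : exists2 C, 0 < C & forall h, `|i h| <= C * `|h|.
Proof. exact: linear_lipschitz ci. Qed.

Lemma iadjP x k : dual x -> x (i k) = ip k (j x).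
Proof.
move=> dx; have [C C0 xC] := dual_bounded dx; have [D D0 iD] := i_bounded.
apply: (@rieszP _ _ _ hilbertH (x \o i) (C * D)).
  by move=> b u v; rewrite /= linearP dx.1.
by move=> u; rewrite (le_trans (xC _))// -mulrA ler_wpM2l// ltW.
Qed.

Lemma iadj_linear b (x y : E -> R^o) : dual x -> dual y ->
  j (b *: x + y) = b *: j x + j y.
Proof.
move=> dx dy; apply: (ip_ext hilbertH) => k; rewrite ipr -!iadjP//.
exact: (dual_subspace E).2.
Qed.

Lemma dual_orbit x t : dual x -> 0 <= t -> dual (x \o S t).
Proof.
move=> [lx cx] t0; have [cS _ _ _] := sgS; split.
  by move=> b u v; rewrite /= linearP lx.
by move=> u; apply: continuous_comp; [exact: cS|exact: cx].
Qed.

Lemma iadj_orbit x t : dual x -> 0 <= t -> j (x \o S t) = a t (j x).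
Proof.
move=> dx t0; apply: (ip_ext hilbertH) => k.
rewrite -(iadjP k (dual_orbit dx t0)) -(adjoint_semigroupP hilbertH sgSH _ _ t0).
by rewrite -(iadjP _ dx) (SHS t0).
Qed.

(** What is orthogonal to the range of [i^*] is sent to [0] by all functionals
    composed with the injection [i]. *)
Lemma iadj_dense g e : 0 < e -> exists2 x, dual x & `|j x - g| < e.
Proof.
move=> e0.
have lphi b (x y : E -> R^o) : dual x -> dual y ->
    ip (j (b *: x + y)) g = b * ip (j x) g + ip (j y) g.
  by move=> dx dy; rewrite iadj_linear// ipl.
have bphi (x : E -> R^o) : dual x -> `|ip (j x) g| <= `|g| * `|j x|.
  by move=> _; rewrite mulrC; exact: ip_cauchy_schwarz.
have [k [_ kg kd]] := riesz_through hilbertH (dual_subspace E) iadj_linear lphi bphi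
  (normr_ge0 g).
suff <- : k = g by have [x dx xk] := kd e e0; exists x.
apply: inj_i; apply: dual_separates => x dx.
by rewrite !iadjP// ipC (ipC ip g) kg.
Qed.

(** [H] is the reproducing kernel Hilbert space of [i \o i^*]. *)
Lemma range_bounded h C : 0 <= C -> (forall y, dual y -> `|y h| <= C * `|j y|) ->
  exists2 g, i g = h & `|g| <= C.
Proof.
move=> C0 hC.
have [g [gC gP _]] := @riesz_through _ _ _ hilbertH (E -> R^o) dualE j
  (fun y => y h) C (dual_subspace E) iadj_linear (fun _ _ _ _ _ => erefl) hC C0.
exists g => //; apply: dual_separates => y dy.
by rewrite iadjP// ipC gP.
Qed.

Local Notation Qt := (covQt ip i S).

(** The integrand of [Q_t x] is the orbit [S_H(s) S_H(s)^* i^* x] in [H]; its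
    continuity rests on that of the adjoint semigroup. *)
Lemma covQt_integrand_continuous h : continuous (fun s : R => i (SH `|s| (a `|s| h))).
Proof.
move=> s; apply: (@continuous_comp _ _ _ (fun s : R => SH `|s| (a `|s| h)) i);
  last exact: ci.
have [M M0 MP] := semigroup_locally_bounded sgSH (`|s| + 1).
have M1 : 0 < M + 1 by rewrite ltr_wpDl.
apply/cvgrPdist_lt => e e0.
have e1 : 0 < e / 2 / (M + 1) by rewrite !divr_gt0.
have /cvgrPdist_lt/(_ _ e1) := @semigroup_continuous _ _ _ sga h s.
have /cvgrPdist_lt/(_ _ (divr_gt0 e0 (ltr0n _ 2))) :=
  @semigroup_continuous _ _ _ sgSH (a `|s| h) s.
move=> n1 n2; near=> r.
have r1 : `|s - r| < 1.
  by near: r; apply/nbhs_ballP; exists 1 => //= r; rewrite -ball_normE.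
have h1 : `|SH `|s| (a `|s| h) - SH `|r| (a `|s| h)| < e / 2 by near: r.
have h2 : `|a `|s| h - a `|r| h| < e / 2 / (M + 1) by near: r.
have h3 : `|SH `|r| (a `|s| h - a `|r| h)| <= M * `|a `|s| h - a `|r| h|.
  apply: MP; rewrite normr_ge0/=.
  have := ler_dist_dist r s; rewrite (distrC r s) => h3.
  by have := ler_norm (`|r| - `|s|); lra.
rewrite linearB in h3.
have h4 : M * `|a `|s| h - a `|r| h| <= e / 2.
  have h4 := ltW h2; rewrite ler_pdivlMr// mulrC in h4.
  by apply: le_trans h4; rewrite ler_wpM2r// lerDl.
have h5 := ler_distD (SH `|r| (a `|s| h)) (SH `|s| (a `|s| h)) (SH `|r| (a `|r| h)).
by rewrite (le_lt_trans h5)// [ltRHS]splitr ltr_leD//; exact: le_trans h4.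
Unshelve. all: by end_near. Qed.

Lemma covQt_form t x y : 0 < t -> dual x -> dual y ->
  y (Qt t x) = itv_integral (fun s : R => ip (a `|s| (j x)) (a `|s| (j y))) t.
Proof.
move=> t0 dx dy.
pose F (s : R) := i (SH `|s| (a `|s| (j x))).
have fF r : 0 <= r <= t -> S r (covQ ip i (x \o S r)) = F r.
  move=> /andP[r0 _]; rewrite /F /covQ -/(j _) iadj_orbit// ger0_norm//.
  by rewrite -SHS.
have cF : continuous F by exact: covQt_integrand_continuous.
have ex := continuous_bochner_integral t0 cF fF.
have b := xgetPex point ex.
rewrite (bochner_integral_weak t0 cF fF b dy).
apply: itv_integral_eq => s /andP[s0 _] /=.
by rewrite /F iadjP// adjoint_semigroupP.
Qed.

Local Notation P := (energy a).

Lemma covQt_energy t x : 0 < t -> dual x -> x (Qt t x) = P (j x) t.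
Proof.
move=> t0 dx; rewrite covQt_form//; apply: itv_integral_eq => s _.
by rewrite hilbertH.
Qed.

Lemma covQt_symmetric t : 0 < t -> positive_symmetric (Qt t).
Proof.
move=> t0; split=> [x y dx dy|x dx]; last by rewrite covQt_energy// energy_ge0.
by rewrite !covQt_form//; apply: itv_integral_eq => s _; rewrite ipC.
Qed.

Context (Qinf : (E -> R) -> E).
Hypothesis Qinf_limit : forall x, dual x ->
  weak_cvg (fun t : R => Qt t x) (+oo : set_system R) (Qinf x).

Lemma cvg_pinfty_le (f : R -> R) (l c : R) :
  f t @[t --> +oo] --> l -> (forall t, 0 < t -> f t <= c) -> l <= c.
Proof.
move=> /cvgrPdist_lt fl fc; apply/ler_addgt0Pr => e e0.
have [M [_ hM]] := fl e e0.
have m0 : 0 < Num.max M 0 + 1 by rewrite ltr_wpDl// le_max lexx orbT.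
have := hM (Num.max M 0 + 1); rewrite ltr_pwDr//; last by rewrite le_max lexx.
by move=> /(_ isT); have := fc _ m0; rewrite ltr_norml => h1 /andP[_ h2]; lra.
Qed.

Lemma Qinf_cvg x y : dual x -> dual y -> y (Qt t x) @[t --> +oo] --> y (Qinf x).
Proof. by move=> dx dy; exact: Qinf_limit. Qed.

Lemma Qinf_le x c : dual x -> (forall t, 0 < t -> P (j x) t <= c) -> x (Qinf x) <= c.
Proof.
move=> dx h; apply: (cvg_pinfty_le (Qinf_cvg dx dx)) => t t0.
by rewrite covQt_energy// h.
Qed.

Lemma energy_le_Qinf x t : dual x -> 0 <= t -> P (j x) t <= x (Qinf x).
Proof.
move=> dx t0; apply/ler_addgt0Pr => e e0.
have /cvgrPdist_lt/(_ e e0)[M [_ hM]] := Qinf_cvg dx dx.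
pose s := Num.max M t + 1.
have Ms : M < s by rewrite ltr_pwDr// le_max lexx.
have ts : t <= s by rewrite ler_wpDr// le_max lexx orbT.
have s0 : 0 < s by rewrite ltr_wpDl// le_max t0 orbT.
have := hM s Ms; rewrite covQt_energy// ltr_norml => /andP[h _].
have := energy_le sga (j x) t0 ts; lra.
Qed.

Lemma Qinf_symmetric : positive_symmetric Qinf.
Proof.
split=> [x y dx dy|x dx]; last first.
  exact: le_trans (energy_ge0 _ _ _) (energy_le_Qinf dx (lexx 0)).
apply: (@cvg_unique _ (@Rhausdorff R)) (Qinf_cvg dy dx) _.
apply: cvg_trans (Qinf_cvg dx dy); apply: near_eq_cvg; near=> t.
by rewrite (covQt_symmetric _).1//; near: t; exact: nbhs_pinfty_gt.
Unshelve. all: by end_near. Qed.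

(** Splitting the integral over the half-line at time [t]. *)
Lemma Qinf_orbit x t : dual x -> 0 <= t ->
  x (Qinf x) = P (j x) t + (x \o S t) (Qinf (x \o S t)).
Proof.
move=> dx t0; have dxt := dual_orbit dx t0.
apply/eqP; rewrite eq_le; apply/andP; split.
  apply: Qinf_le => // s s0; have [st|ts] := leP s t.
    rewrite (le_trans (energy_le sga (j x) (ltW s0) st))// lerDl.
    exact: Qinf_symmetric.2.
  rewrite -[s in P _ s](subrK t) addrC (energyD sga)//; last by rewrite subr_ge0 ltW.
  by rewrite lerD2l -iadj_orbit// energy_le_Qinf// subr_ge0 ltW.
rewrite addrC -lerBrDr; apply: Qinf_le => // s s0.
rewrite iadj_orbit// lerBrDr addrC -(energyD sga)//; last exact: ltW.
by apply: energy_le_Qinf => //; rewrite addr_ge0// ltW.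
Qed.

Local Notation pinf := (range_norm Qinf).
Local Notation pt t := (range_norm (Qt t)).
Local Notation Hinf := (rkhs Qinf).
Local Notation Ninf := (rkhs_norm Qinf).
Local Notation Ht t := (rkhs (Qt t)).
Local Notation Nt t := (rkhs_norm (Qt t)).

Lemma pinf_sqr x : dual x -> pinf x ^+ 2 = x (Qinf x).
Proof. exact: (range_normK Qinf_symmetric). Qed.

Lemma pt_sqr t x : 0 < t -> dual x -> pt t x ^+ 2 = P (j x) t.
Proof. by move=> t0 dx; rewrite (range_normK (covQt_symmetric t0))// covQt_energy. Qed.

Lemma pt_le_pinf t x : 0 < t -> dual x -> pt t x <= pinf x.
Proof.
move=> t0 dx; rewrite -(ler_pXn2r (n := 2))// ?nnegrE ?range_norm_ge0//.
by rewrite pt_sqr// pinf_sqr// energy_le_Qinf// ltW.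
Qed.

(** The energy left after time [t] is that of the orbit started at [a t (j x)],
    which commutes with the semigroup. *)
Lemma pinf_orbit x t c : dual x -> 0 <= t -> 0 <= c ->
  (forall h, `|a t h| <= c * `|h|) -> pinf (x \o S t) <= c * pinf x.
Proof.
move=> dx t0 c0 ac; have dxt := dual_orbit dx t0.
rewrite -(ler_pXn2r (n := 2))// ?nnegrE ?mulr_ge0 ?range_norm_ge0//.
rewrite exprMn !pinf_sqr//; apply: Qinf_le => // s s0.
rewrite iadj_orbit// (le_trans (energy_shift sga _ _ t0 ac))//.
by rewrite ler_wpM2l ?exprn_ge0// energy_le_Qinf// ltW.
Qed.

(** When at most half of [pinf] is left after time [t], the energy spent by then
    controls the total. *)
Lemma Qinf_le_energy x t : dual x -> 0 <= t ->
  pinf (x \o S t) <= 2^-1 * pinf x -> x (Qinf x) <= 2 * P (j x) t.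
Proof.
move=> dx t0 h; have dxt := dual_orbit dx t0.
have h2 : pinf (x \o S t) ^+ 2 <= (2^-1 * pinf x) ^+ 2.
  by rewrite ler_pXn2r// ?nnegrE ?mulr_ge0 ?range_norm_ge0// invr_ge0.
rewrite exprMn !pinf_sqr// in h2.
have q0 := Qinf_symmetric.2 _ dx.
have F : 2^-1 ^+ 2 = 4^-1 :> R by field.
have := Qinf_orbit dx t0; rewrite F in h2.
by have := energy_ge0 a (j x) t; lra.
Qed.

Lemma equiv_norms_of_bound t C : 0 < t -> 0 < C ->
  (forall x, dual x -> pinf x <= C * pt t x) ->
  eq_equiv_norms (Ht t) (Nt t) Hinf Ninf.
Proof.
move=> t0 C0 hC; have pst := covQt_symmetric t0; have psi := Qinf_symmetric.
have tinf h : Ht t h -> Hinf h /\ Ninf h <= Nt t h.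
  move=> /(rkhs_normP pst)[N0 hN]; apply: (rkhs_bounded psi) => // y dy.
  by rewrite (le_trans (hN y dy))// ler_wpM2l// pt_le_pinf.
have inft h : Hinf h -> Ht t h /\ Nt t h <= Ninf h * C.
  move=> /(rkhs_normP psi)[N0 hN]; apply: (rkhs_bounded pst).
    by rewrite mulr_ge0// ltW.
  move=> y dy; rewrite (le_trans (hN y dy))// -mulrA ler_wpM2l//.
  exact: hC.
split; first by apply/seteqP; split=> h; [move=> /tinf[]|move=> /inft[]].
exists C^-1, 1; split; rewrite ?invr_gt0// => h hh.
have [hi le1] := tinf h hh; have [_ le2] := inft h hi.
by rewrite mul1r le1 andbT ler_pdivrMl// mulrC.
Qed.

(** Testing the equivalence of the norms on [Qinf x], of norm [pinf x], bounds
    [pinf] by [pt t], which only sees a bounded stretch of the orbit. *)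
Lemma bound_of_equiv_norms t : 0 < t ->
  eq_equiv_norms (Ht t) (Nt t) Hinf Ninf ->
  exists2 K, 0 <= K & forall x, dual x -> pinf x <= K * `|j x|.
Proof.
move=> t0 [Heq [c [C [c0 C0 cC]]]].
have pst := covQt_symmetric t0; have psi := Qinf_symmetric.
have [K K0 KP] := energy_bounded sga (ltW t0).
exists (c^-1 * Num.sqrt K); first by rewrite mulr_ge0 ?sqrtr_ge0// invr_ge0 ltW.
move=> x dx.
have ptK : pt t x <= Num.sqrt K * `|j x|.
  rewrite -(ler_pXn2r (n := 2))// ?nnegrE ?mulr_ge0 ?range_norm_ge0 ?sqrtr_ge0//.
  by rewrite pt_sqr// exprMn sqr_sqrtr// KP.
suff : pinf x <= c^-1 * pt t x.
  by move=> h; rewrite (le_trans h)// -mulrA ler_wpM2l// invr_ge0 ltW.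
have [hx Nx] := rkhs_range psi dx.
have hxt : Ht t (Qinf x) by rewrite Heq.
have [_ hN] := rkhs_normP pst hxt.
have := hN x dx; have /andP[h1 _] := cC _ hxt.
have [->|n0] := eqVneq (pinf x) 0.
  by rewrite mulr_ge0 ?range_norm_ge0// invr_ge0 ltW.
have np : 0 < pinf x by rewrite lt_def n0 range_norm_ge0.
rewrite ger0_norm ?psi.2// -pinf_sqr// => h2.
rewrite ler_pdivlMl//.
have h3 : c * Nt t (Qinf x) <= pinf x := le_trans h1 Nx.
rewrite -(ler_pM2l np) mulrCA -expr2.
apply: (le_trans (ler_wpM2l (ltW c0) h2)).
by rewrite mulrA ler_wpM2r// range_norm_ge0.
Qed.

Lemma energy_triangle u v t : 0 <= t -> P (u + v) t <= 2 * P u t + 2 * P v t.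
Proof.
move=> t0; rewrite /energy -[X in _ <= _ + X]itv_integralZ; last exact: (energy_continuous sga).
have c2 : continuous (fun s : R => 2 * `|a `|s| v| ^+ 2).
  by move=> s; apply: cvgMr; exact: (energy_continuous sga).
rewrite -itv_integral_lin//; last exact: (energy_continuous sga).
apply: itv_integral_le; first exact: (energy_continuous sga).
  move=> s; apply: cvgD; last exact: c2.
  by apply: cvgMr; exact: (energy_continuous sga).
move=> s _; rewrite (linearD (a _)).
have h1 := ler_normD (a `|s| u) (a `|s| v).
have h2 := sqr_ge0 (`|a `|s| u| - `|a `|s| v|).
have h3 := normr_ge0 (a `|s| u + a `|s| v).
move: h1 h2 h3; move: `|_ + _| `|a `|s| u| `|a `|s| v| => x y z; nra.
Qed.

(** The energy of [j x] is at most [K^2 |j x|^2]; by density of the range of [j]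
    all orbits of the adjoint semigroup are square integrable, with a bound
    independent of the time, and Datko's theorem applies. *)
Lemma stable_of_bound K : 0 <= K ->
  (forall x, dual x -> pinf x <= K * `|j x|) ->
  unif_exp_stable [set: H] (fun h => `|h|) SH.
Proof.
move=> K0 hK.
have en t h : 0 <= t -> P h t <= (8 * K ^+ 2 + 2) * `|h| ^+ 2.
  move=> t0; have [C C0 CP] := energy_bounded sga t0.
  have [->|h0] := eqVneq h 0.
    by have := CP 0; rewrite normr0 expr0n !mulr0.
  have hp : 0 < `|h| by rewrite normr_gt0.
  have C1 : 0 < C + 1 by rewrite ltr_wpDl.
  (* [C] depends on [t], so the error must be small enough to absorb it. *)
  have [x dx xh] := iadj_dense h (divr_gt0 hp C1).
  have e1 : `|h| / (C + 1) <= `|h|.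
    by rewrite ler_pdivrMr// ler_peMr// lerDr.
  have jx : `|j x| <= 2 * `|h|.
    have := ler_normD (j x - h) h; rewrite subrK.
    by move: (`|h| / _) e1 xh => e; lra.
  have Pj : P (j x) t <= K ^+ 2 * (4 * `|h| ^+ 2).
    apply: (le_trans (energy_le_Qinf dx t0)); rewrite -pinf_sqr//.
    have -> : K ^+ 2 * (4 * `|h| ^+ 2) = (K * (2 * `|h|)) ^+ 2 by ring.
    rewrite ler_pXn2r// ?nnegrE ?mulr_ge0 ?range_norm_ge0//.
    by rewrite (le_trans (hK x dx))// ler_wpM2l.
  have Pd : P (h - j x) t <= `|h| ^+ 2.
    apply: (le_trans (CP _)).
    have : `|h - j x| ^+ 2 <= (`|h| / (C + 1)) ^+ 2.
      rewrite ler_pXn2r// ?nnegrE ?divr_ge0// ?(ltW C1)//.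
      by rewrite distrC ltW.
    move=> /(ler_wpM2l C0)/le_trans; apply.
    rewrite expr_div_n mulrA ler_pdivrMr ?exprn_gt0// mulrC ler_wpM2l ?exprn_ge0//.
    by have := sqr_ge0 C; nra.
  have := energy_triangle (j x) (h - j x) t0; rewrite addrC subrK.
  have -> : (8 * K ^+ 2 + 2) * `|h| ^+ 2 = 2 * (K ^+ 2 * (4 * `|h| ^+ 2)) + 2 * `|h| ^+ 2.
    by ring.
  by move: (K ^+ 2 * _) Pj => z; lra.
have K1 : 0 <= 8 * K ^+ 2 + 2 by rewrite addr_ge0// mulr_ge0// exprn_ge0.
have [M [w [M0 w0 aM]]] := datko sga K1 (fun t h => @en t h).
exists M, w; split=> // t t0 h _; split=> //.
exact: (@adjoint_semigroup_bound_inv _ _ _ hilbertH _ sgSH t _ t0 (aM t t0)).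
Qed.

Lemma adjoint_stable : unif_exp_stable [set: H] (fun h => `|h|) SH ->
  exists M w : R, [/\ 0 <= M, 0 < w &
    forall t, 0 <= t -> forall h, `|a t h| <= M * expR (- (w * t)) * `|h|].
Proof.
move=> [M [w [M0 w0 hM]]]; exists M, w; split=> // t t0.
by apply: (adjoint_semigroup_bound hilbertH sgSH t0) => k; exact: (hM t t0 k Logic.I).2.
Qed.

Lemma Hinf_stable_of_stable : unif_exp_stable [set: H] (fun h => `|h|) SH ->
  unif_exp_stable Hinf Ninf S.
Proof.
move=> /adjoint_stable[M [w [M0 w0 aM]]]; exists M, w; split=> // t t0 h hh.
have psi := Qinf_symmetric; have [N0 hN] := rkhs_normP psi hh.
have c0 : 0 <= M * expR (- (w * t)) by rewrite mulr_ge0// expR_ge0.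
apply: (rkhs_bounded psi); first exact: mulr_ge0.
move=> y dy; apply: (le_trans (hN _ (dual_orbit dy t0))).
have -> : M * expR (- (w * t)) * Ninf h * pinf y =
  Ninf h * (M * expR (- (w * t)) * pinf y) by ring.
rewrite ler_wpM2l//.
exact: (pinf_orbit dy t0 c0 (aM t t0)).
Qed.

(** By duality the decay on [H_inf] passes to [pinf]: test the decay on the
    element [Qinf (x \o S t)] of [H_inf]. *)
Lemma pinf_orbit_of_Hinf_stable M w t x : 0 <= M ->
  (forall h, Hinf h -> Hinf (S t h) /\ Ninf (S t h) <= M * expR (- (w * t)) * Ninf h) ->
  dual x -> 0 <= t -> pinf (x \o S t) <= M * expR (- (w * t)) * pinf x.
Proof.
move=> M0 hM dx t0; have dxt := dual_orbit dx t0; have psi := Qinf_symmetric.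
have c0 : 0 <= M * expR (- (w * t)) by rewrite mulr_ge0// expR_ge0.
have [n0|n0] := eqVneq (pinf (x \o S t)) 0.
  by rewrite n0 mulr_ge0// range_norm_ge0.
have np : 0 < pinf (x \o S t) by rewrite lt_def n0 range_norm_ge0.
have [hq Nq] := rkhs_range psi dxt; have [hS NS] := hM _ hq.
have [_ /(_ x dx) b] := rkhs_normP psi hS.
rewrite -(ler_pM2l np) -expr2 pinf_sqr//=.
apply: (le_trans (ler_norm _)); apply: (le_trans b).
rewrite mulrA ler_wpM2r ?range_norm_ge0// mulrC (le_trans NS)//.
by rewrite ler_wpM2l.
Qed.

Lemma energy_le_Qinf_bound t C x : 0 < t -> 0 <= C -> dual x ->
  x (Qinf x) <= C * P (j x) t -> pinf x <= (Num.sqrt C + 1) * pt t x.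
Proof.
move=> t0 C0 dx h.
have sC : 0 <= Num.sqrt C + 1 by rewrite addr_ge0// sqrtr_ge0.
rewrite -(ler_pXn2r (n := 2))// ?nnegrE ?mulr_ge0 ?range_norm_ge0//.
rewrite pinf_sqr// exprMn pt_sqr// (le_trans h)// ler_wpM2r ?energy_ge0//.
by rewrite -{1}(sqr_sqrtr C0) ler_pXn2r ?nnegrE ?sqrtr_ge0// lerDl.
Qed.

Lemma equiv_norms_of_Hinf_stable : unif_exp_stable Hinf Ninf S ->
  exists2 t, 0 < t & eq_equiv_norms (Ht t) (Nt t) Hinf Ninf.
Proof.
move=> [M [w [M0 w0 hM]]]; have [t t0 tP] := exp_decay_small M0 w0.
have C0 : 0 < Num.sqrt 2 + 1 :> R by rewrite ltr_wpDl// sqrtr_ge0.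
exists t => //; apply: (equiv_norms_of_bound t0 C0).
move=> x dx; apply: energy_le_Qinf_bound => //.
apply: Qinf_le_energy => //; first exact: ltW.
apply: (le_trans (pinf_orbit_of_Hinf_stable M0 (hM t (ltW t0)) dx (ltW t0))).
by rewrite ler_wpM2r ?range_norm_ge0// tP.
Qed.

(** For a small [t], at most half of [pinf] is left after enough multiples of
    [t], and the energy of each stretch of length [t] is dominated by that of the first. *)
Lemma equiv_norms_of_stable : unif_exp_stable [set: H] (fun h => `|h|) SH ->
  forall t, 0 < t -> eq_equiv_norms (Ht t) (Nt t) Hinf Ninf.
Proof.
move=> /adjoint_stable[M [w [M0 w0 aM]]] t t0.
have [t1 t10 t1P] := exp_decay_small M0 w0.
pose n := Num.bound (t1 / t).
have nt : t1 <= n%:R * t.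
  by rewrite -ler_pdivrMr// ltW// archi_boundP// divr_ge0// ltW.
have nt0 (k : nat) : 0 <= k%:R * t by rewrite mulr_ge0// ltW.
have [C C0 CP] : exists2 C, 0 <= C & forall h, P h (n%:R * t) <= C * P h t.
  elim: n {nt} => [|n [C C0 ih]].
    exists 0 => // h.
    by rewrite !mul0r /energy /itv_integral set_itv1 Rintegral_set1.
  exists (C + (M * expR (- (w * (n%:R * t)))) ^+ 2).
    by rewrite addr_ge0// exprn_ge0// mulr_ge0// expR_ge0.
  move=> h; rewrite -natr1 mulrDl mul1r (energyD sga) ?(ltW t0)//.
  rewrite mulrDl lerD//; apply: (energy_shift sga) => //; exact: aM.
have C1 : 0 < Num.sqrt (2 * C) + 1 by rewrite ltr_wpDl// sqrtr_ge0.
apply: (equiv_norms_of_bound t0 C1).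
move=> x dx; apply: energy_le_Qinf_bound => //; first exact: mulr_ge0.
rewrite -mulrA (le_trans (Qinf_le_energy dx (nt0 n) _)) ?ler_wpM2l//.
have c0 : 0 <= M * expR (- (w * (n%:R * t))) by rewrite mulr_ge0// expR_ge0.
apply: (le_trans (pinf_orbit dx (nt0 n) c0 (aM _ (nt0 n)))).
by rewrite ler_wpM2r ?range_norm_ge0// t1P.
Qed.

Lemma Hinf_subset_of_bound K : 0 <= K ->
  (forall x, dual x -> pinf x <= K * `|j x|) ->
  forall h, Hinf h -> exists2 g, i g = h & `|g| <= Ninf h * K.
Proof.
move=> K0 hK h /(rkhs_normP Qinf_symmetric)[N0 hN].
apply: range_bounded; first exact: mulr_ge0.
by move=> y dy; rewrite (le_trans (hN y dy))// -mulrA ler_wpM2l// hK.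
Qed.

(** The closed graph theorem for the inclusion of [H_inf] in [H]. If the bound
    fails, the functionals [x n] divided by [|j (x n)|], which are bounded at
    every point of [H], are unbounded on the unit ball of [H_inf], and a gliding
    hump yields a point of [H_inf] at which they are unbounded. *)
Lemma bound_of_subset : Hinf `<=` range i ->
  exists2 K, 0 <= K & forall x, dual x -> pinf x <= K * `|j x|.
Proof.
move=> sub; apply: contrapT => nK; have psi := Qinf_symmetric.
have xex (n : nat) : exists x, dual x /\ 2 * n%:R * 3 ^+ n * `|j x| < pinf x.
  apply: contrapT => nx; apply: nK; exists (2 * n%:R * 3 ^+ n).
    by rewrite !mulr_ge0// exprn_ge0.
  by move=> x dx; rewrite leNgt; apply/negP => h; apply: nx; exists x.
have [x xP] := choice xex.
have dx n : dual (x n) := (xP n).1.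
have p0 n : 0 < pinf (x n).
  by apply: le_lt_trans (xP n).2; rewrite !mulr_ge0// exprn_ge0.
have j0 n : 0 < `|j (x n)|.
  rewrite lt_def normr_ge0 andbT normr_eq0; apply/eqP => jx.
  have : pinf (x n) ^+ 2 <= 0.
    rewrite pinf_sqr//; apply: Qinf_le => // t t0.
    have [C C0 CP] := energy_bounded sga (ltW t0).
    by have := CP (j (x n)); rewrite jx normr0 expr0n mulr0.
  by rewrite leNgt exprn_gt0.
pose f n (u : E -> R^o) : R := u (Qinf (x n)) / `|j (x n)|.
pose v n : E -> R^o := (pinf (x n))^-1 *: (x n : E -> R^o).
have fv n : f n (v n) = pinf (x n) / `|j (x n)|.
  rewrite /f /v -[((pinf (x n))^-1 *: _) _]/((pinf (x n))^-1 * x n (Qinf (x n))).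
  by rewrite -pinf_sqr// expr2 mulKf// gt_eqF.
have dv n : dual (v n) by apply: (subspaceZ (dual_subspace E)).
have [||||||| |u [du uc uf]] := @gliding_hump R (E -> R^o) dualE pinf f v.
- exact: dual_subspace.
- move=> y z dy dz; exact: (form_normD (dual_subspace E) (operator_form psi)).
- move=> b y dy; exact: (form_normZ (dual_subspace E) (operator_form psi)).
- by move=> n b y z _ _; rewrite /f -[(b *: y + z) _]/(b * y _ + z _) mulrDl mulrA.
- move=> n y dy; rewrite fv /f normrM normfV normr_id mulrAC.
  rewrite ler_wpM2r ?invr_ge0// mulrC.
  exact: (operator_cauchy_schwarz psi).
- exact: dv.
- move=> n; have -> : pinf (v n) = `|(pinf (x n))^-1| * pinf (x n).
    exact: (form_normZ (dual_subspace E) (operator_form psi)).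
  by rewrite normfV gtr0_norm// mulVf// gt_eqF.
- by move=> n; rewrite fv ler_pdivlMr// ltW// (xP n).2.
have small (c : R) : 0 < c -> exists N, 4 * 3 ^- N < c :> R.
  move=> c0; have := @cvg_geometric R 4 3^-1.
  rewrite ger0_norm ?invr_ge0// invf_lt1// ltr1n => /(_ isT)/cvg_seqP/(_ _ c0)[N].
  move=> /(_ N (leqnn N)); rewrite subr0 /geometric ger0_norm ?mulr_ge0// exprVn => h.
  by exists N.
have ucau : form_cauchy (fun y z : E -> R^o => (y (Qinf z) : R)) u.
  move=> e e0; have [N hN] := small e e0; exists N => m n Nm Nn.
  have -> : u m - u n = (u m - u N) + (-1) *: (u n - u N).
    by rewrite scaleN1r opprB addrA subrK.
  have dB k := subspaceB (dual_subspace E) (du k) (du N).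
  apply: (le_lt_trans (form_normD (dual_subspace E) (operator_form psi) (dB m)
    (subspaceZ (dual_subspace E) _ (dB n)))).
  rewrite (form_normZ (dual_subspace E) (operator_form psi))// normrN normr1 mul1r.
  apply: le_lt_trans hN.
  by have := uc _ _ Nm; have := uc _ _ Nn; rewrite /range_norm /form_norm; lra.
have [h uh] := range_cauchy_cvg psi du ucau.
have hh : Hinf h by exists u; split.
have [g _ gh] := sub h hh.
pose N := Num.bound `|g|.
have : `|g| < N%:R by exact: archi_boundP.
rewrite ltNge => /negP; apply.
have : N%:R <= `|x N h| / `|j (x N)|.
  have cv : (- (`|x N (Qinf (u m))| / `|j (x N)|)) @[m --> \oo] -->
      - (`|x N h| / `|j (x N)|).
    apply: cvgN; apply: cvgMl; apply: cvg_norm.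
    by apply: (cvg_comp _ _ uh); exact: (dx N).2.
  rewrite -lerN2; apply: (cvg_seq_le (N := N.+1) cv) => m Nm; rewrite lerN2.
  have := uf N m Nm; rewrite /f normrM normfV normr_id.
  by rewrite (psi.1 _ _ (du m) (dx N)).
move/le_trans; apply; rewrite ler_pdivrMr// -gh iadjP//.
exact: ip_cauchy_schwarz.
Qed.

Lemma Hinf_preimage_subspace : linear_subspace (i @^-1` Hinf).
Proof.
have psi := Qinf_symmetric; split=> [|b u v] /=.
  apply: (rkhs_bounded psi (C := 0) _ _).1 => // y dy.
  by rewrite linear0 (scalar_fun0 dy.1) normr0 mul0r.
move=> /(rkhs_normP psi)[N0 hN] /(rkhs_normP psi)[N'0 hN'].
apply: (rkhs_bounded psi (C := `|b| * Ninf (i u) + Ninf (i v)) _ _).1.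
  by rewrite addr_ge0// mulr_ge0.
move=> y dy; rewrite linearP dy.1 (le_trans (ler_normD _ _))// mulrDl lerD ?hN'//.
by rewrite normrM -mulrA ler_wpM2l// hN.
Qed.

Lemma energy_eq0 g : (forall t, 0 < t -> P g t <= 0) -> g = 0.
Proof.
move=> Pg; apply: contrapT => /eqP g0.
have gp : 0 < `|g| by rewrite normr_gt0.
have [_ _ _ ac] := sga.
have [d d0 dP] := (cvg_right0P _ _).1 (ac g) (`|g| / 2) (divr_gt0 gp (ltr0n _ 2)).
have t0 : 0 < d / 2 by rewrite divr_gt0.
have := Pg _ t0; rewrite leNgt => /negP; apply.
apply: (@lt_le_trans _ _ ((`|g| / 2) ^+ 2 * (d / 2))).
  by rewrite mulr_gt0// exprn_gt0// divr_gt0.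
rewrite -(itv_integral_cst ((`|g| / 2) ^+ 2) (ltW t0)); apply: itv_integral_le.
- by move=> s; exact: cvg_cst.
- exact: (energy_continuous sga).
move=> s /andP[s0 sd]; rewrite ger0_norm// ler_pXn2r// ?nnegrE ?divr_ge0//.
have [->|sn0] := eqVneq s 0.
  by rewrite adjoint_semigroup0 ler_pdivrMr// ler_peMr// ler1n.
have sp : 0 < s by rewrite lt_def sn0.
have sd' : s < d by apply: (le_lt_trans sd); rewrite gtr_pMr// invf_lt1// ltr1n.
have := dP s sp sd'; have := lerB_dist g (a s g); rewrite (distrC g); lra.
Qed.

(** An element [g] of [H] orthogonal to [H_inf] is orthogonal to [Qinf y] for
    each [y]; letting [i^* y] tend to [g], all orbits of [g] have no energy. *)
Lemma Hinf_dense : Hinf `<=` range i -> dense (i @^-1` Hinf).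
Proof.
move=> sub; have [K K0 hK] := bound_of_subset sub; have psi := Qinf_symmetric.
suff orth g : (forall u, (i @^-1` Hinf) u -> ip u g = 0) -> g = 0.
  move=> O [g Og] oO.
  have /nbhs_ballP[e e0 eO] : nbhs g O by apply: open_nbhs_nbhs.
  have [u uH ug] := subspace_approx hilbertH Hinf_preimage_subspace orth g e0.
  exists u; split=> //; apply: eO.
  by rewrite -ball_normE /= distrC.
move=> og; apply: energy_eq0 => t t0.
have [C C0 CP] := energy_bounded sga (ltW t0).
pose A := 2 * (K ^+ 2 * (`|g| + 1)) + 2 * C + 1.
have A0 : 0 < A.
  by rewrite ltr_wpDl// addr_ge0// ?mulr_ge0// ?exprn_ge0// addr_ge0.
apply/ler_addgt0Pr => e e0; rewrite add0r.
have e1 : 0 < Num.min 1 (e / A) by rewrite lt_min ltr01 divr_gt0.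
have [y dy] := iadj_dense g e1; rewrite lt_min => /andP[y1 yA].
have [hq Nq] := rkhs_range psi dy.
have [k ik kN] := Hinf_subset_of_bound K0 hK hq.
have kg : ip k g = 0 by apply: og; rewrite /= ik.
have jy : `|j y| <= `|g| + 1.
  by have := ler_normD (j y - g) g; rewrite subrK; lra.
have kK : `|k| <= K ^+ 2 * (`|g| + 1).
  apply: (le_trans kN); apply: (@le_trans _ _ (K * `|j y| * K)).
    by rewrite ler_wpM2r// (le_trans Nq)// hK.
  by rewrite mulrAC -expr2 ler_wpM2l// exprn_ge0.
have Qy : y (Qinf y) <= K ^+ 2 * (`|g| + 1) * `|j y - g|.
  rewrite -ik iadjP// -[ip k (j y)]subr0 -kg -ipBr (le_trans (ip_le hilbertH _ _))//.
  by rewrite ler_wpM2r.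
have Pd : P (g - j y) t <= C * `|j y - g|.
  rewrite (le_trans (CP _))// distrC ler_wpM2l// expr2 ler_piMr//.
  exact: ltW.
have := energy_triangle (j y) (g - j y) (ltW t0); rewrite addrC subrK.
have := energy_le_Qinf dy (ltW t0).
rewrite ltr_pdivlMr// /A in yA.
have := normr_ge0 (j y - g).
move: Qy Pd yA; move: (K ^+ 2 * _) `|j y - g| => B z; nra.
Qed.

End StabilityOfCovariance.

Theorem theorem5p4 (R : realType) (E : completeNormedModType R)
    (S : R -> {linear E -> E}) (semigroupS : C0_semigroup S)
    (H : completeNormedModType R) (ip : {dot H for (idfun : R -> R)})
    (hilbertH : induces_norm ip)
    (i : {linear H -> E}) (continuous_i : continuous i)
    (injective_i : injective i)
    (Qinf : (E -> R) -> E)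
    (Qinf_weak_limit : forall x, dual x ->
       weak_cvg (fun t : R => covQt ip i S t x) (+oo : set_system R) (Qinf x))
    (SH : R -> {linear H -> H}) (semigroupSH : C0_semigroup SH)
    (SH_restricts_S : forall t, 0 <= t -> forall h, i (SH t h) = S t (i h)) :
  let Ht t := rkhs (covQt ip i S t) in
  let Ht_norm t := rkhs_norm (covQt ip i S t) in
  let Hinf := rkhs Qinf in
  let Hinf_norm := rkhs_norm Qinf in
  [<-> unif_exp_stable [set: H] (fun h => `|h|) SH;
       unif_exp_stable Hinf Hinf_norm S;
       exists2 t, 0 < t & eq_equiv_norms (Ht t) (Ht_norm t) Hinf Hinf_norm;
       forall t, 0 < t -> eq_equiv_norms (Ht t) (Ht_norm t) Hinf Hinf_norm;
       Hinf `<=` range i]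
  /\ (Hinf `<=` range i -> dense (i @^-1` Hinf)).
Proof.
move=> Ht Ht_norm Hinf Hinf_norm; split; last first.
  exact: (Hinf_dense semigroupS hilbertH continuous_i injective_i semigroupSH).
tfae.
- exact: (Hinf_stable_of_stable semigroupS hilbertH continuous_i semigroupSH).
- exact: (equiv_norms_of_Hinf_stable semigroupS hilbertH continuous_i semigroupSH).
- move=> [t t0 eqt].
  have [K K0 hK] := bound_of_equiv_norms semigroupS hilbertH continuous_i semigroupSH
    SH_restricts_S Qinf_weak_limit t0 eqt.
  apply: (equiv_norms_of_stable semigroupS hilbertH continuous_i semigroupSH) => //.
  exact: (stable_of_bound semigroupS hilbertH continuous_i injective_i semigroupSH
    SH_restricts_S Qinf_weak_limit K0 hK).
- move=> /(_ 1 ltr01) eqt h hh.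
  have [K K0 hK] := bound_of_equiv_norms semigroupS hilbertH continuous_i semigroupSH
    SH_restricts_S Qinf_weak_limit ltr01 eqt.
  have [g gh _] := Hinf_subset_of_bound semigroupS hilbertH continuous_i semigroupSH
    SH_restricts_S Qinf_weak_limit K0 hK hh.
  by exists g.
- move=> sub.
  have [K K0 hK] := bound_of_subset semigroupS hilbertH continuous_i semigroupSH
    SH_restricts_S Qinf_weak_limit sub.
  exact: (stable_of_bound semigroupS hilbertH continuous_i injective_i semigroupSH
    SH_restricts_S Qinf_weak_limit K0 hK).
Qed.
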